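(* Let $d\in\mathbb{N}$, $\alpha>1/2$, and let $1\ge\gamma_1\ge\gamma_2\ge\cdots>0$ be product weights. Let $\tau>0$ and $\delta\in(0,1)$ be given, and let $N$ be a prime sufficiently large that $1\le N_*<N/2$ and $$\frac{4(1+\tau)}{1+\tau\log N_*}<1 .$$ Moreover, let $R$ be an odd integer sufficiently large such that $$\Big(1+\frac{N-1}{1+\tau\log N_*}\Big)\left(\frac{4(1+\tau)}{1+\tau\log N_*}\right)^{\lceil R/2\rceil}\le\delta .$$ Then, with probability at least $1-\delta$, we have that for any $f\in\mathcal{H}_{d,\alpha,\boldsymbol{\gamma}}$, the output $A^{\mathrm{rand}}(f)$ of the median lattice-based algorithm satisfies $$\|f-A^{\mathrm{rand}}(f)\|_{L_2}^2\le\frac{\|f\|_{d,\alpha,\boldsymbol{\gamma}}^2}{N_*^{2\alpha}}\Big(2\tau^{-1}+1+\frac{2N}{N-1}\log(N-1)\Big).$$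
   Context: **Korobov space.** For $\boldsymbol{h}\in\mathbb{Z}^d$ put $r_{2\alpha,\boldsymbol{\gamma}}(\boldsymbol{h})=\prod_{j=1}^d\max\{|h_j|^{2\alpha}/\gamma_j,1\}$. The weighted Korobov space $\mathcal{H}_{d,\alpha,\boldsymbol{\gamma}}$ is the Hilbert space of functions $f$ on $[0,1]^d$, one-periodic in each variable and equal pointwise to their absolutely convergent Fourier series $f(\boldsymbol{x})=\sum_{\boldsymbol{h}\in\mathbb{Z}^d}\widehat f(\boldsymbol{h})\exp(2\pi \mathrm{i}\,\boldsymbol{h}\cdot\boldsymbol{x})$, where $\widehat f(\boldsymbol{h})=\int_{[0,1]^d}f(\boldsymbol{x})\exp(-2\pi \mathrm{i}\,\boldsymbol{h}\cdot\boldsymbol{x})\,d\boldsymbol{x}$, with finite norm $\|f\|_{d,\alpha,\boldsymbol{\gamma}}=\big(\sum_{\boldsymbol{h}\in\mathbb{Z}^d}|\widehat f(\boldsymbol{h})|^2r_{2\alpha,\boldsymbol{\gamma}}(\boldsymbol{h})\big)^{1/2}$. $\|\cdot\|_{L_2}$ is the norm of $L_2([0,1]^d)$. **Parameters.** For $\tau>0$ and prime $N$, $$P_N(\tau,d,\boldsymbol{\gamma})=\prod_{j=1}^d\big(1+2\gamma_j^{1/(2\alpha)}(1+\tau\log N)\big),\qquad N_*=\frac{N-1}{\exp(\tau^{-1})P_N(\tau,d,\boldsymbol{\gamma})},$$ and $\mathcal{A}_d(N_* )=\{\boldsymbol{h}\in\mathbb{Z}^d: r_{2\alpha,\boldsymbol{\gamma}}(\boldsymbol{h})\le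 N_*^{2\alpha}\}$. **Median lattice-based algorithm.** Given $\tau$, a prime $N$ and an odd $R\in\mathbb{N}$, draw independently, for $r=1,\dots,R$, $\boldsymbol{z}_r$ uniformly from $\{1,\dots,N-1\}^d$ and $\boldsymbol{\Delta}_r$ uniformly from $[0,1)^d$. For $\boldsymbol{h}\in\mathcal{A}_d(N_* )$ set $$\widehat f_{N,\boldsymbol{z}_r,\boldsymbol{\Delta}_r}(\boldsymbol{h})=\frac1N\sum_{k=0}^{N-1}f\Big(\Big\{\frac{k\boldsymbol{z}_r}{N}+\boldsymbol{\Delta}_r\Big\}\Big)\exp\Big(-2\pi \mathrm{i}\,\boldsymbol{h}\cdot\Big(\frac{k\boldsymbol{z}_r}{N}+\boldsymbol{\Delta}_r\Big)\Big),$$ where $\{\cdot\}$ is the componentwise fractional part, and let $\widehat f_{\mathrm{med}}(\boldsymbol{h})$ be the median over $r\in\{1,\dots,R\}$ of these numbers, the median of complex numbers being the median of the real parts plus $\mathrm{i}$ times the median of the imaginary parts. The output is $(A^{\mathrm{rand}}(f))(\boldsymbol{x})=\sum_{\boldsymbol{h}\in\mathcal{A}_d(N_* )}\widehat f_{\mathrm{med}}(\boldsymbol{h})\exp(2\pi \mathrm{i}\,\boldsymbol{h}\cdot\boldsymbol{x})$. Probability is over the random choice of all $\boldsymbol{z}_r,\boldsymbol{\Delta}_r$.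
   Formalization: The bound is proved for each fixed f with probability at least 1−δ, so the good event may depend on f; a single event good for all f at once is impossible in general (it fails for d=1, γ_1=1 and α near 1/2). *)

(* Defs.v *)
From HB Require Import structures.
From mathcomp Require Import all_boot all_order all_algebra finmap complex.
From mathcomp Require Import all_classical all_reals all_analysis.
Set Implicit Arguments.
Unset Strict Implicit.
Unset Printing Implicit Defensive.
Import Order.TTheory GRing.Theory Num.Theory numFieldNormedType.Exports.
Import ComplexField.Normc.
Local Open Scope classical_set_scope.
Local Open Scope ring_scope.
Local Open Scope complex_scope.

Section iid.
Context {dsp : measure_display} {T : measurableType dsp} {R : realType}.

Definition tcons n (p : T * n.-tuple T) : n.+1.-tuple T :=
  [tuple of p.1 :: p.2].

Lemma measurable_tcons n : measurable_fun [set: T * n.-tuple T] (@tcons n).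
Proof.
exact: (@measurable_cons _ _ _ _ _ _ _ measurable_fst measurable_snd).
Qed.

HB.instance Definition _ n := isMeasurableFun.Build _ _ _ _ (@tcons n)
  (@measurable_tcons n).

(* Law of n independent draws from P, i.e. the n-fold product measure. *)
Fixpoint iid (P : probability T R) n : probability (n.-tuple T) R :=
  match n with
  | 0 => \d_ ([tuple] : 0.-tuple T)
  | n'.+1 => distribution (P \x iid P n')%E (@tcons n')
  end.

End iid.

(* Points of R^d; measurableTypeR R is R itself with its Borel sigma-algebra. *)
Notation vec R d := (d.-tuple (measurableTypeR R)).

(* Lebesgue measure on [0,1]^d. As a probability measure on R^d it is also the
   uniform law on [0,1)^d, since the faces x_j = 1 are null. *)
Definition cube_measure (R : realType) d : probability (vec R d) R :=
  iid (uniform_prob (@ltr01 R)) d.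

Section korobov.
Context {R : realType} {d : nat}.
Implicit Types (f g : vec R d -> R[i]) (h : d.-tuple int) (x : vec R d).

Definition dot h x : R := \sum_(j < d) (tnth h j)%:~R * (tnth x j : R).

(* exp(2 pi i t) *)
Definition expi2pi (t : R) : R[i] := cos (2 * pi * t) +i* sin (2 * pi * t).

Definition cube_integral f : R[i] :=
  (\int[cube_measure R d]_x complex.Re (f x)) +i* (\int[cube_measure R d]_x complex.Im (f x)).

Definition fourier_coef f h : R[i] :=
  cube_integral (fun x => f x * expi2pi (- dot h x)).

(* The unordered sum of the family u is s. *)
Definition has_sum (I : choiceType) (u : I -> R[i]) (s : R[i]) : Prop :=
  forall e : R, 0 < e -> exists A0 : {fset I}, forall A : {fset I},
    (A0 `<=` A)%fset -> normc (\sum_(i <- A) u i - s) < e.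

(* Here and below gamma j stands for the (j+1)-st weight, j = 0, 1, ... *)
Definition korobov_weight (alpha : R) (gamma : nat -> R) h : R :=
  \prod_(j < d) Num.max (`|(tnth h j)%:~R| `^ (2 * alpha) / gamma j) 1.

Definition korobov_sqnorm (alpha : R) (gamma : nat -> R) f : \bar R :=
  (\esum_(h in [set: d.-tuple int])
    (normc (fourier_coef f h) ^+ 2 * korobov_weight alpha gamma h)%:E)%E.

Definition korobov_norm (alpha : R) (gamma : nat -> R) f : R :=
  Num.sqrt (fine (korobov_sqnorm alpha gamma f)).

(* Functions on [0,1]^d that are one-periodic in each variable are represented
   by their periodic extensions to R^d. *)
Definition one_periodic f : Prop :=
  forall x (j : 'I_d), f [tuple (tnth x i : R) + (i == j)%:R | i < d] = f x.

Definition korobov_space (alpha : R) (gamma : nat -> R) :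
    set (vec R d -> R[i]) :=
  [set f | [/\ one_periodic f,
    (\esum_(h in [set: d.-tuple int]) (normc (fourier_coef f h))%:E < +oo)%E,
    forall x, has_sum (fun h => fourier_coef f h * expi2pi (dot h x)) (f x) &
    (korobov_sqnorm alpha gamma f < +oo)%E]].

Definition L2norm g : \bar R :=
  Lnorm (cube_measure R d) 2%:E (fun x => (normc (g x))%:E).

End korobov.

Section parameters.
Context {R : realType} (d N : nat) (alpha : R) (gamma : nat -> R) (tau : R).

Definition PN : R :=
  \prod_(j < d) (1 + 2 * gamma j `^ (2 * alpha)^-1 * (1 + tau * ln N%:R)).

Definition Nstar : R := (N%:R - 1) / (expR tau^-1 * PN).

Definition index_set : set (d.-tuple int) :=
  [set h | korobov_weight alpha gamma h <= Nstar `^ (2 * alpha)].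

End parameters.

Section median_algorithm.
Context {R : realType} {d : nat}.
Implicit Types (f : vec R d -> R[i]) (h : d.-tuple int) (x : vec R d).

Definition fracpart (t : R) : R := t - (Num.floor t)%:~R.

(* k z / N + Delta *)
Definition lattice_point (N : nat) (z : d.-tuple nat) (Delta : vec R d)
    (k : nat) : vec R d :=
  [tuple k%:R * (tnth z j)%:R / N%:R + (tnth Delta j : R) | j < d].

Definition lattice_coef (N : nat) f h (z : d.-tuple nat) (Delta : vec R d) :
    R[i] :=
  N%:R^-1 * \sum_(k < N)
    f [tuple of map fracpart (lattice_point N z Delta k)] *
    expi2pi (- dot h (lattice_point N z Delta k)).

(* The middle entry of the sorted sequence, for sequences of odd length. *)
Definition median (s : seq R) : R := (sort <=%R s)`_(size s)./2.

Definition cmedian (s : seq R[i]) : R[i] :=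
  median [seq complex.Re c | c <- s] +i* median [seq complex.Im c | c <- s].

(* A draw ((z_1, Delta_1), ..., (z_m, Delta_m)). *)
Notation draw m := (m.-tuple (d.-tuple nat * vec R d)%type).

Definition median_coef (N m : nat) (w : draw m) f h : R[i] :=
  cmedian [seq lattice_coef N f h p.1 p.2 | p <- w].

Definition median_algorithm (alpha : R) (gamma : nat -> R) (tau : R)
    (N m : nat) (w : draw m) f x : R[i] :=
  \sum_(h \in index_set N alpha gamma tau)
    median_coef N w f h * expi2pi (dot h x).

End median_algorithm.

Section randomness.
Context (R : realType) (d N : nat).

Definition generating_vectors : set (d.-tuple nat) :=
  [set z | forall j : 'I_d, (1 <= tnth z j <= N.-1)%N].

Lemma measurable_generating_vectors : measurable generating_vectors.
Proof.
rewrite (_ : generating_vectors = \bigcap_(j in [set: 'I_d])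
    (setT `&` (@tnth d nat ^~ j) @^-1` [set k | (1 <= k <= N.-1)%N])).
  by apply: fin_bigcap_measurable => // j _; exact: measurable_tnth.
apply/seteqP; split => z /= Hz j; first by move=> _; split => //; exact: Hz.
by have [] := Hz j I.
Qed.

(* Normalized counting measure on {1, ..., N-1}^d; the last argument of
   mnormalize is only a default for the degenerate case where this set is
   empty. *)
Definition uniform_generating_vector : probability (d.-tuple nat) R :=
  mnormalize (mrestr (@counting _ R) measurable_generating_vectors)
    \d_ [tuple 1%N | _ < d].

Definition draw_law m : probability (m.-tuple (d.-tuple nat * vec R d)) R :=
  iid (uniform_generating_vector \x cube_measure R d)%E m.

End randomness.

(* A is only required to contain a measurable event of probability at least p;
   for measurable A this is p <= P A. *)
Definition with_probability_at_least {dsp : measure_display}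
    {T : measurableType dsp} {R : realType} (P : probability T R) (p : R)
    (A : set T) : Prop :=
  exists E : set T, [/\ measurable E, E `<=` A & (p%:E <= P E)%E].

(* Main.v *)
Require Import Defs.
From HB Require Import structures.
From mathcomp Require Import all_boot all_order all_algebra finmap complex.
From mathcomp Require Import all_classical all_reals all_analysis.
From mathcomp Require Import measurable_realfun ring lra zify.
Set Implicit Arguments.
Unset Strict Implicit.
Unset Printing Implicit Defensive.
Import Order.TTheory GRing.Theory Num.Theory numFieldNormedType.Exports.
Local Open Scope classical_set_scope.
Local Open Scope ring_scope.

(* For fixed f with Fourier coefficients c and one draw (z, Delta), the error of
   the h-th lattice coefficient is the sum of c_l exp(2 pi i (l - h).Delta) over
   the l <> h aliased with h, i.e. (l - h).z = 0 mod N.  Put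
   L = 1 + tau log N_*.  For h in the index set A the draw is bad if some other
   element of A is aliased with h, or if the squared error exceeds V_h / p2,
   where p2 = tau / L and V_h bounds the mean over z and Delta of the squared
   contribution of the l outside A.  For l incongruent to h mod N, aliasing has
   probability at most 1 / (N - 1), and |A| <= 1 + (N - 1) / L, so the first case
   has probability at most 1 / L; by Bessel's inequality in Delta and Markov's
   inequality the second one has probability at most p2.  The median at h can
   only fail if more than half of the draws are bad, which has probability at
   most (4 (1 + tau) / L) ^ ceil(m / 2) for m draws; a union bound over A gives delta.
   Otherwise the median errors sum up to at most 2 (1 + 1/L) / p2 times the sum
   of |c_l|^2 over l outside A, since A has no two congruent elements. *)

(** * Sums of nonnegative families, Markov's inequality and union bounds *)

Section sums_and_measures.
Context {R : realType}.

Lemma sum_fset_le_esum (I : choiceType) (b : I -> R) (F : {fset I}) :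
  (forall i, 0 <= b i) ->
  ((\sum_(i <- F) b i)%:E <= \esum_(i in [set: I]) (b i)%:E)%E.
Proof.
move=> b0; apply: esum_ge; exists [set` F]; first by split => //; exact: finite_fset.
by rewrite fsbig_finite//= set_fsetK sumEFin.
Qed.

(** A finite supremum is attained up to [e] by some finite [F], so the terms outside [F] add at most
    [e]; this makes the approximation in [trig_poly_approx] uniform in [x]. *)
Lemma esum_approx (I : choiceType) (b : I -> R) (e : R) :
  (forall i, 0 <= b i) -> (\esum_(i in [set: I]) (b i)%:E < +oo)%E -> 0 < e ->
  exists F : {fset I}, forall G : {fset I}, \sum_(i <- G) b i <= \sum_(i <- F) b i + e.
Proof.
move=> b0 boo e0.
have b0' : (0 <= \esum_(i in [set: I]) (b i)%:E)%E.
  by apply: esum_ge0 => i _; rewrite lee_fin.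
have bfin : \esum_(i in [set: I]) (b i)%:E \is a fin_num by rewrite ge0_fin_numE.
have [_ [X [finX _] <-]] := ub_ereal_sup_adherent e0 bfin.
rewrite -/(esum _ _) fsbig_finite//= sumEFin => lt.
exists (fset_set X) => G; rewrite -lee_fin EFinD -leeBlDr//.
apply: le_trans (ltW lt); apply: leeD2r; exact: sum_fset_le_esum.
Qed.

Lemma esum_le_scale (I : choiceType) (a b : I -> R) (k K : R) :
  (forall i, 0 <= a i) -> 0 <= k -> (forall i, b i <= k * a i) ->
  (\esum_(i in [set: I]) (a i)%:E <= K%:E)%E ->
  (\esum_(i in [set: I]) (b i)%:E <= (k * K)%:E)%E.
Proof.
move=> a0 k0 ba aK; apply: ge_ereal_sup => _ [X [finX _] <-].
rewrite fsbig_finite//= sumEFin lee_fin.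
apply: (@le_trans _ _ (k * \sum_(i <- fset_set X) a i)).
  by rewrite mulr_sumr; apply: ler_sum.
rewrite ler_wpM2l// -lee_fin; apply: le_trans aK; exact: sum_fset_le_esum.
Qed.

Lemma sum_fset_split (V : zmodType) (I : choiceType) (u : I -> V) (F G : {fset I}) :
  (F `<=` G)%fset ->
  \sum_(i <- G) u i = \sum_(i <- F) u i + \sum_(i <- G | i \notin F) u i.
Proof.
move=> FG; rewrite (bigID (mem F))/=; congr (_ + _).
rewrite -big_filter; apply: perm_big; apply: uniq_perm; rewrite ?filter_uniq//.
by move=> i; rewrite mem_filter andb_idr// => /(fsubsetP FG).
Qed.

(** Markov's inequality in product form, which also makes sense for [t = 0]. *)
Lemma markov_gt {dT : measure_display} {T : measurableType dT}
    (mu : {measure set T -> \bar R}) (F : T -> R) (t : R) :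
  measurable_fun setT F -> (forall x, 0 <= F x) -> 0 <= t ->
  (t%:E * mu [set x | (t < F x)%R] <= \int[mu]_x (F x)%:E)%E.
Proof.
move=> mF F0 t0; set D := [set x | _].
have mD : measurable D.
  have := mF measurableT `]t, +oo[%classic (measurable_itv _); rewrite setTI.
  by congr measurable; apply/seteqP; split => x /=; rewrite in_itv/= andbT.
rewrite -integral_cst//; apply: (@le_trans _ _ (\int[mu]_(x in D) (F x)%:E)%E).
  apply: ge0_le_integral => //.
  - by apply/measurable_EFinP; exact: measurable_funTS.
  - by move=> x Dx; rewrite lee_fin ltW.
apply: ge0_subset_integral => //; first exact/measurable_EFinP.
by move=> x _; rewrite lee_fin.
Qed.

Lemma measure_bigsetU_le {dT : measure_display} {T : measurableType dT}
    (mu : {measure set T -> \bar R}) (I : eqType) (s : seq I) (F : I -> set T) :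
  (forall i, i \in s -> measurable (F i)) ->
  measurable (\big[setU/set0]_(i <- s) F i) /\
  (mu (\big[setU/set0]_(i <- s) F i) <= \sum_(i <- s) mu (F i))%E.
Proof.
elim: s => [|i s IH] mF; first by rewrite !big_nil measure0.
have mi : measurable (F i) by apply: mF; rewrite mem_head.
have [ms les] := IH (fun j js => mF j (mem_behead (s := i :: s) js)).
rewrite !big_cons; split; first exact: measurableU.
by apply: le_trans (measureU2 _ _ _) _ => //; exact: leeD2l.
Qed.
End sums_and_measures.

(** * Counting the index set *)

Section counting.
Context {R : realType}.

(** Comparison with the integral of x^(-(1+e)) over x >= 1, in telescoping form: for k >= 2,
    k^(-(1+e)) is at most ((k-1)^(-e) - k^(-e)) / e. *)
Lemma zeta_bound (e : R) (K : nat) : 0 < e ->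
  \sum_(k < K) (k.+1%:R : R) `^ (- (1 + e)) <= 1 + e^-1.
Proof.
move=> e0; case: K => [|K]; first by rewrite big_ord0 addr_ge0 ?invr_ge0 ?ltW.
rewrite big_ord_recl /= powR1 lerD2l.
suff: \sum_(i < K) (bump 0 i).+1%:R `^ (- (1 + e)) <= e^-1 * (1 - K.+1%:R `^ (- e)).
  by move/le_trans; apply; rewrite ler_piMr ?invr_ge0 ?ltW//.
elim: K => [|K IH]; first by rewrite big_ord0 powR1 subrr mulr0.
rewrite big_ord_recr /=; apply: (le_trans (lerD IH (lexx _))).
have k0 : 0 < (K.+2%:R : R) by [].
have k1 : 0 < (K.+1%:R : R) by [].
rewrite -lerBrDl -mulrBr -(ler_pM2l e0) mulrA divff ?gt_eqF// mul1r.
have -> (a b : R) : 1 - a - (1 - b) = b - a by ring.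
rewrite /bump /= add1n.
(* Since K+1 = (1-u)(K+2), division by (K+2)^(-e) leaves 1 + e u <= (1-u)^(-e), which follows from
   ln(1-u) <= -u and 1 + x <= exp x. *)
set u : R := K.+2%:R^-1.
have u0 : 0 < u by rewrite invr_gt0.
have u1 : 0 < 1 - u by rewrite subr_gt0 invf_lt1// ltr1n.
have -> : K.+1%:R = (1 - u) * K.+2%:R :> R.
  by rewrite mulrBl mulVf ?gt_eqF// mul1r -[K.+2%:R]natr1 addrK.
have k0' : K.+2%:R != 0 :> R by [].
rewrite (powRM _ (ltW u1) (ltW k0)) opprD powRD ?k0' ?implybT//.
rewrite (powR_inv1 (ltW k0)) -/u mulrA -{3}(mul1r (_ `^ _)) -mulrBl.
rewrite ler_pM2r ?powR_gt0// lerBrDl.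
rewrite /powR gt_eqF//.
have le1 : ln (1 - u) <= - u.
  by apply: le_ln1Dx; rewrite ltrN2 invf_lt1 ?ltr1n.
apply: le_trans (expR_ge1Dx _) _.
by rewrite ler_expR; nra.
Qed.

(* With g_j = gamma_j^(1/(2 alpha)), the Korobov weight to the power
   1/(2 alpha). *)
Definition wt (g : nat -> R) d (h : d.-tuple int) : R :=
  \prod_(j < d) Num.max (`|(tnth h j)%:~R| / g j) 1.

Lemma wt_ge1 g d (h : d.-tuple int) : 1 <= wt g h.
Proof.
rewrite /wt; elim/big_ind: _ => // [x y x1 y1|i _]; last by rewrite le_max lexx orbT.
by rewrite -[1]mulr1 ler_pM.
Qed.

Lemma wt_cons g d (k : int) (h : d.-tuple int) :
  wt g [tuple of k :: h] = Num.max (`|k%:~R| / g 0%N) 1 * wt (g \o S) h.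
Proof.
rewrite /wt big_ord_recl tnth0; congr (_ * _); apply: eq_bigr => i _.
by rewrite tnthS.
Qed.

(* C_d = (prod_j (1 + 2 g_j L) - 1) / L solves C_0 = 0,
   C_(d+1) = 2 g + C_d (1 + 2 g L), the recursion obtained in [count_wt] by
   summing over one more coordinate. *)
Definition count_const (g : nat -> R) (L : R) d : R :=
  (\prod_(j < d) (1 + 2 * g j * L) - 1) / L.

Lemma count_constS g L d : 0 < L -> count_const g L d.+1 =
  2 * g 0%N + count_const (g \o S) L d * (1 + 2 * g 0%N * L).
Proof.
move=> L0; rewrite /count_const big_ord_recl /=.
have -> : \prod_(i < d) (1 + 2 * g (bump 0 i) * L) =
  \prod_(i < d) (1 + 2 * g i.+1 * L) by apply: eq_bigr => i _.
by field; rewrite gt_eqF.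
Qed.

Lemma count_const_ge0 g L d : 0 < L -> (forall j, 0 < g j) ->
  0 <= count_const g L d.
Proof.
move=> L0 g0; apply: divr_ge0; last exact: ltW.
rewrite subr_ge0; elim/big_ind: _ => // [x y x1 y1|i _].
  by rewrite -[1]mulr1 ler_pM.
by rewrite lerDl !mulr_ge0// ltW.
Qed.

(** Zero comes first because its fibre in [count_wt] supplies the leading 1, while both signs obey
    the same bound. *)
Definition zrange (K : nat) : seq int :=
  (0 :> int) :: ([seq (k.+1%:Z : int) | k <- iota 0 K] ++
     [seq (- k.+1%:Z : int) | k <- iota 0 K]).

Lemma mem_zrange K (k : int) : (`|k| <= K)%N -> k \in zrange K.
Proof.
case: k => [[|k]|k] /= kK; rewrite /zrange inE // mem_cat; apply/orP; right.
  by apply/orP; left; apply/mapP; exists k => //; rewrite mem_iota.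
apply/orP; right; apply/mapP; exists k; last by rewrite NegzE.
by rewrite mem_iota.
Qed.

Lemma sum_le_count (Y : R) K : 0 <= Y ->
  \sum_(k < K) (nat_of_bool (k.+1%:R <= Y)%R)%:R <= Y.
Proof.
elim: K Y => [|K IH] Y Y0; first by rewrite big_ord0.
rewrite big_ord_recr /=; have [le|lt] := leP K.+1%:R Y; last by rewrite addr0 IH.
apply: le_trans le; rewrite -natr1 lerD2r.
have -> : K%:R = \sum_(k < K) (1 : R) by rewrite sumr_const card_ord.
by apply: ler_sum => i _; case: (_ <= Y).
Qed.

(* Keeping the 1 (from h = 0) apart from the X^(1+e) term is what gains the
   factor L over the bound X^(1+e) prod_j (1 + 2 g_j L). *)
Lemma count_wt (e : R) d (g : nat -> R) (K : nat) : 0 < e ->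
  (forall j, 0 < g j) -> (forall j, g j <= 1) -> forall X : R,
  exists s : seq (d.-tuple int),
  (forall h : d.-tuple int, (forall j, `|tnth h j|%N <= K)%N -> wt g h <= X -> h \in s) /\
  (size s)%:R <= (if 1 <= X then 1 + X `^ (1 + e) * count_const g (1 + e^-1) d else 0).
Proof.
move=> e0; set L := 1 + e^-1.
have L0 : 0 < L by rewrite addr_gt0 ?invr_gt0.
elim: d g => [|d IH] g g0 g1 X.
  (* In dimension 0 the only tuple has the empty product 1 as its weight. *)
  exists (if 1 <= X then [:: [tuple]] else [::]); split.
    by move=> h _; rewrite /wt big_ord0 => ->; rewrite tuple0 inE.
  case: ifP => // _; rewrite lerDl mulr_ge0 ?powR_ge0//.
  exact: count_const_ge0.
(* Lists for all bounds are needed at once: fixing the first coordinate [k] turns the bound on the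
   remaining ones into [X / m k]. *)
have [f Hf] := choice (IH (g \o S) (fun j => g0 j.+1) (fun j => g1 j.+1)).
have [X1|X1] := leP 1 X; last first.
  exists [::]; split => // h _ hX.
  by have := le_lt_trans (le_trans (wt_ge1 g h) hX) X1; rewrite ltxx.
pose m (k : int) := Num.max (`|k%:~R| / g 0%N) 1.
exists (flatten [seq [seq cons_tuple k t | t <- f (X / m k)] | k <- zrange K]).
split.
  move=> h hK; case/tupleP: h hK => k t hK; rewrite wt_cons => hX.
  apply/allpairsPdep; exists k; exists t; split => //.
    by apply: mem_zrange; have := hK ord0; rewrite tnth0.
  apply: (Hf _).1 => [j|].
    by have := hK (lift ord0 j); rewrite tnthS.
  by rewrite ler_pdivlMr 1?mulrC// lt_max ltr01 orbT.
rewrite size_allpairs_dep.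
set C := count_const (g \o S) L d.
have C0 : 0 <= C by apply: count_const_ge0 => //= j.
have X0 : 0 < X by apply: lt_le_trans X1.
have m0 k : 0 < m k by rewrite lt_max ltr01 orbT.
(* [b k] bounds the length of the list for first coordinate k+1 or -(k+1): the indicator comes from
   the 1 of the induction hypothesis, the power term from the rest by g^(1+e) <= g. *)
pose b (k : nat) : R := (nat_of_bool (k.+1%:R <= g 0%N * X)%R)%:R +
   X `^ (1 + e) * g 0%N * C * (k.+1%:R `^ (- (1 + e))).
have Hb (k : nat) (z : int) : `|z|%N = k.+1 -> (size (f (X / m z)))%:R <= b k.
  move=> zk; apply: le_trans (Hf _).2 _.
  have mz : m z = k.+1%:R / g 0%N.
    rewrite /m -intr_norm -abszE zk; apply/max_idPl.
    rewrite ler_pdivlMr// mul1r; apply: le_trans (g1 _) _.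
    by rewrite ler1n.
  rewrite mz ler_pdivlMr ?divr_gt0// mul1r /b.
  rewrite ler_pdivrMr// [g _ * X]mulrC; case: (k.+1%:R <= _); last first.
    rewrite /= add0r; apply: mulr_ge0; last exact: powR_ge0.
    by apply: mulr_ge0 => //; rewrite mulr_ge0 ?powR_ge0 ?(ltW (g0 _)).
  rewrite lerD2l -/C invf_div [X * (_ / _)]mulrA powRM ?divr_ge0 ?mulr_ge0 ?invr_ge0 ?(ltW X0) ?(ltW (g0 _))//.
  rewrite powRM ?(ltW X0) ?(ltW (g0 _))//.
  have -> : k.+1%:R^-1 `^ (1 + e) = k.+1%:R `^ (- (1 + e)) :> R.
    by rewrite -powR_inv1// -powRrM mulN1r.
  set x := X `^ _; set y := _ `^ (- _); set z' := g _ `^ _.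
  have -> : x * z' * y * C = (x * y * C) * z' by ring.
  have -> : x * g 0%N * C * y = (x * y * C) * g 0%N by ring.
  have xyC : 0 <= x * y * C by apply: mulr_ge0 C0; rewrite mulr_ge0 ?powR_ge0.
  apply: (ler_wpM2l xyC).
  by apply: ge1r_powR; rewrite ?g0 ?g1// lerDl ltW.
have Hs (F : nat -> R) : \sum_(i <- iota 0 K) F i = \sum_(i < K) F i.
  by rewrite -(big_mkord xpredT) /index_iota subn0.
have sumb : \sum_(k < K) b k <= g 0%N * X + X `^ (1 + e) * g 0%N * C * L.
  rewrite big_split /= lerD ?sum_le_count ?mulr_ge0 ?(ltW X0) ?(ltW (g0 _))//.
  rewrite -mulr_sumr ler_wpM2l ?zeta_bound//; apply: mulr_ge0 C0.
  by rewrite mulr_ge0 ?powR_ge0 ?(ltW (g0 _)).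
have X0e : (size (f (X / m 0)))%:R <= 1 + X `^ (1 + e) * C.
  have -> : m 0 = 1 by rewrite /m normr0 mul0r max_r.
  by rewrite divr1; have := (Hf X).2; rewrite X1.
have XXe : X <= X `^ (1 + e) by rewrite le1r_powR// lerDl ltW.
rewrite sumnE big_map natr_sum /zrange big_cons big_cat !big_map /= !Hs.
have S1 : \sum_(k < K) (size (f (X / m k.+1%:Z)))%:R <= \sum_(k < K) b k.
  by apply: ler_sum => k _; apply: Hb.
have S2 : \sum_(k < K) (size (f (X / m (- k.+1%:Z))))%:R <= \sum_(k < K) b k.
  by apply: ler_sum => k _; apply: Hb; rewrite abszN.
apply: le_trans (lerD X0e (lerD (le_trans S1 sumb) (le_trans S2 sumb))) _.
rewrite count_constS// -/C.
(* After cancellation the claim is 2 (G Y - G X) >= 0, which follows from X <= X^(1+e). *)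
have := ler_wpM2l (ltW (g0 0%N)) XXe.
set Y := X `^ _; set G := g _ => GX.
rewrite -subr_ge0; have -> : 1 + Y * (2 * G + C * (1 + 2 * G * L)) -
  (1 + Y * C + (G * X + Y * G * C * L + (G * X + Y * G * C * L))) =
  2 * (G * Y - G * X) by ring.
by rewrite mulr_ge0// subr_ge0.
Qed.

(** One factor is at least |h_j| because g_j <= 1, and the others are at least 1. Hence the index
    set lies in a box of half-width N_*, which makes it finite and, as N_* < N/2, free of distinct
    indices congruent mod N. *)
Lemma le_wt g d (h : d.-tuple int) j : (forall i, 0 < g i) -> (forall i, g i <= 1) ->
  `|(tnth h j)%:~R| <= wt g h.
Proof.
move=> g0 g1; rewrite /wt (bigD1 j)//= -[leLHS]mulr1 ler_pM//.
  rewrite le_max ler_pdivlMr ?g0// ler_piMr ?g1//.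
elim/big_ind: _ => // [x y x1 y1|i _]; last by rewrite le_max lexx orbT.
by rewrite -[1]mulr1 ler_pM.
Qed.

(** The map x -> x^(2 alpha) is multiplicative and increasing on x >= 0, so it passes through the
    product and through the maximum with 1. *)
Lemma korobov_weight_wt (alpha : R) gamma d (h : d.-tuple int) :
  0 < alpha -> (forall j, 0 < gamma j) ->
  korobov_weight alpha gamma h = wt (fun j => gamma j `^ (2 * alpha)^-1) h `^ (2 * alpha).
Proof.
move=> a0 g0; have a0' : 0 < 2 * alpha by rewrite mulr_gt0.
rewrite /korobov_weight /wt.
(* Nonnegativity of the partial products is carried along for [powRM]. *)
suff [] : 0 <= wt (fun j => gamma j `^ (2 * alpha)^-1) h /\
  korobov_weight alpha gamma h =
  wt (fun j => gamma j `^ (2 * alpha)^-1) h `^ (2 * alpha) by [].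
rewrite /korobov_weight /wt.
elim/big_rec2: _ => [|j x y _ [x0 ->]]; first by rewrite powR1.
set m := Num.max (_ / _ `^ _) _.
have m0 : 0 <= m by rewrite le_max ler01 orbT.
rewrite powRM//; split; [exact: mulr_ge0|congr (_ * _)].
have p0 : 0 <= `|(tnth h j)%:~R| / gamma j `^ (2 * alpha)^-1 :> R.
  by rewrite divr_ge0 ?powR_ge0.
have -> : `|(tnth h j)%:~R| `^ (2 * alpha) / gamma j =
    (`|(tnth h j)%:~R| / gamma j `^ (2 * alpha)^-1) `^ (2 * alpha).
  rewrite powRM ?invr_ge0 ?powR_ge0//; congr (_ * _).
  by rewrite -powRN -powRrM mulNr mulVf ?gt_eqF// powR_inv1 ?ltW.
have one (r : R) : 1 `^ r = 1 by rewrite powR1.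
rewrite /m; have [le|lt] := leP (_ / _) (1 : R).
  rewrite max_r ?one// -[leRHS](one (2 * alpha)).
  by rewrite ge0_ler_powR ?nnegrE ?ler01 ?p0 ?(ltW a0').
rewrite max_l // -[leLHS](one (2 * alpha)).
by rewrite ge0_ler_powR ?nnegrE ?ler01 ?p0 ?(ltW a0') ?(ltW lt).
Qed.

Section index_set.
Variables (d N : nat) (alpha : R) (gamma : nat -> R) (tau : R).
Hypotheses (alpha_gt0 : 0 < alpha) (gamma_gt0 : forall j, 0 < gamma j)
  (gamma_le1 : forall j, gamma j <= 1) (tau_gt0 : 0 < tau)
  (Nstar_gt1 : 1 < Nstar d N alpha gamma tau)
  (Nstar_leN : Nstar d N alpha gamma tau <= N%:R).

Let M := Nstar d N alpha gamma tau.
Let g j := gamma j `^ (2 * alpha)^-1.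

Let g_gt0 j : 0 < g j. Proof. exact: powR_gt0. Qed.

Let g_le1 j : g j <= 1.
Proof.
have one (r : R) : 1 `^ r = 1 by rewrite powR1.
rewrite /g -[leRHS](one (2 * alpha)^-1).
by rewrite ge0_ler_powR ?nnegrE ?ler01 ?(ltW (gamma_gt0 _)) ?invr_ge0 ?mulr_ge0 ?(ltW alpha_gt0).
Qed.

Lemma index_setE (h : d.-tuple int) :
  index_set N alpha gamma tau h <-> wt g h <= M.
Proof.
have M0 : 0 < M by exact: lt_trans Nstar_gt1.
have w0 : 0 <= wt g h by rewrite (le_trans ler01) ?wt_ge1.
rewrite /index_set /= korobov_weight_wt//; split => [|le].
  apply: contraTT; rewrite -!ltNge => lt.
  by rewrite gt0_ltr_powR ?nnegrE ?mulr_gt0 ?(ltW M0) ?w0.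
apply: (ge0_ler_powR _ _ _ le); rewrite ?nnegrE ?w0 ?(ltW M0)//.
by rewrite mulr_ge0// ltW.
Qed.

Lemma index_set_le (h : d.-tuple int) j :
  index_set N alpha gamma tau h -> `|(tnth h j)%:~R| <= M.
Proof. by move=> /index_setE; apply: le_trans; exact: le_wt. Qed.

(** The exponent e = 1/(tau ln M) is chosen so that 1 + 1/e = 1 + tau ln M and M^(1+e) = M
    exp(1/tau); by the definition of N_*, M exp(1/tau) P_N is N - 1. *)
Lemma index_set_count : exists s : seq (d.-tuple int),
  (forall h, index_set N alpha gamma tau h -> h \in s) /\
  (size s)%:R <= 1 + (N%:R - 1) / (1 + tau * ln M).
Proof.
have M0 : 0 < M by exact: lt_trans Nstar_gt1.
have lnM0 : 0 < ln M by exact: ln_gt0.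
pose e := (tau * ln M)^-1; have e0 : 0 < e by rewrite invr_gt0 mulr_gt0.
pose K := (Num.truncn M).
have [s [sP sizes]] := count_wt d K e0 g_gt0 g_le1 M.
exists s; split => [h hA|].
  apply: sP; last exact/index_setE.
  move=> j; rewrite /K truncn_ge_nat ?(ltW M0)//.
  by rewrite natr_absz intr_norm index_set_le.
apply: le_trans sizes _; rewrite (ltW Nstar_gt1) lerD2l /e invrK /count_const.
set L := 1 + tau * _; have L0 : 0 < L by rewrite addr_gt0 ?mulr_gt0.
rewrite mulrA ler_pM2r ?invr_gt0//.
have ME : M `^ (1 + (tau * ln M)^-1) = M * expR tau^-1.
  have Mn0 : M != 0 by rewrite gt_eqF.
  rewrite powRD ?Mn0 ?implybT// (powRr1 (ltW M0)); congr (_ * _).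
  by rewrite /powR gt_eqF// invfM -mulrA mulVf ?mulr1 ?gt_eqF.
have -> : N%:R - 1 = M * expR tau^-1 * PN d N alpha gamma tau.
  have PN0 : PN d N alpha gamma tau != 0.
    apply: contraTneq Nstar_gt1 => PN0.
    by rewrite /Nstar PN0 mulr0 invr0 mulr0 -leNgt.
  by rewrite /M /Nstar -mulrA divfK// mulf_neq0// gt_eqF// expR_gt0.
rewrite ME; apply: ler_wpM2l; first by rewrite mulr_ge0 ?expR_ge0 ?(ltW M0).
(* The -1 is dropped, and ln M <= ln N bounds each factor by that of [PN]. *)
rewrite lerBlDr.
apply: le_trans (_ : PN d N alpha gamma tau <= _); last by rewrite lerDl.
rewrite /PN; apply: ler_prod => j _; apply/andP; split.
  by rewrite addr_ge0 ?mulr_ge0 ?(ltW L0) ?(ltW (g_gt0 _)).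
rewrite lerD2l; apply: ler_wpM2l; first by rewrite mulr_ge0 ?(ltW (g_gt0 _)).
rewrite lerD2l; apply: ler_wpM2l; first exact: ltW.
by rewrite ler_ln ?posrE// (lt_le_trans M0).
Qed.
End index_set.
End counting.

(** * Tail bound for independent draws and medians *)

Section iid_tail.
Context {dsp : measure_display} {T : measurableType dsp} {R : realType}.

Lemma measurable_count_ge (B : set T) n k : measurable B ->
  measurable [set w : n.-tuple T | (k <= \sum_(j < n) (tnth w j \in B))%N].
Proof.
move=> mB.
pose F (J : {set 'I_n}) := \bigcap_(j in [set j | j \in J]) ((@tnth n T ^~ j) @^-1` B).
rewrite (_ : [set _ | _] = \bigcup_(J in [set J : {set 'I_n} | (k <= #|J|)%N]) F J).
  apply: fin_bigcup_measurable => // J _; apply: fin_bigcap_measurable => // j _.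
  by rewrite -[X in measurable X]setTI; exact: measurable_tnth.
apply/seteqP; split => w /=.
  move=> kw; exists [set j | tnth w j \in B]%SET.
    apply: leq_trans kw _; rewrite -sum1_card [leqRHS]big_mkcond /=.
    by apply: leq_sum => j _; rewrite inE; case: (_ \in _).
  by move=> j /=; rewrite inE => /set_mem.
move=> [J /= kJ] wJ; apply: leq_trans kJ _.
rewrite -sum1_card big_mkcond /=; apply: leq_sum => j _.
by case: ifP => // jJ; rewrite mem_set//; exact: wJ.
Qed.

(** Induction on [n] along Pascal's rule: if at least k+1 of n+1 draws lie in B, then either the
    first one and k of the rest do, or k+1 of the rest do. *)
Lemma iid_tail (P : probability T R) (B : set T) (p : R) n k :
  measurable B -> (P B <= p%:E)%E ->
  (iid P n [set w | (k <= \sum_(j < n) (tnth w j \in B))%N] <=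
    ('C(n, k)%:R * p ^+ k)%:E)%E.
Proof.
move=> mB PB.
have p0 : 0 <= p by rewrite -lee_fin (le_trans _ PB).
elim: n k => [|n IH] [|k].
- rewrite bin0 mul1r expr0; apply: probability_le1.
  exact: measurable_count_ge.
- rewrite bin_small// mul0r (_ : [set _ | _] = set0) ?measure0//.
  by apply/seteqP; split => w //=; rewrite big_ord0.
- rewrite bin0 mul1r expr0; apply: probability_le1.
  exact: measurable_count_ge.
pose S i := [set w : n.-tuple T | (i <= \sum_(j < n) (tnth w j \in B))%N].
have mS i : measurable (S i) by exact: measurable_count_ge.
rewrite /= /distribution /pushforward.
apply: (@le_trans _ _ ((P \x iid P n)%E (B `*` S k `|` setT `*` S k.+1))).
  apply: le_measure; rewrite ?inE.
  - rewrite -[X in measurable X]setTI; apply: measurable_tcons => //.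
    exact: measurable_count_ge.
  - by apply: measurableU; apply: measurableX.
  - move=> [x w] /=; rewrite big_ord_recl tnth0.
    under eq_bigr do rewrite tnthS.
    case: (boolP (x \in B)) => xB; rewrite /= ?add0n ?add1n ?ltnS => H; last by right.
    by left; split => //; exact: set_mem.
apply: (le_trans (measureU2 _ _ _)); try by apply: measurableX.
have E1 : (P \x iid P n)%E (B `*` S k) = (P B * iid P n (S k))%E.
  exact: product_measure1E.
have E2 : (P \x iid P n)%E (setT `*` S k.+1) = iid P n (S k.+1).
  rewrite -[RHS]mul1e -(probability_setT P); exact: product_measure1E.
rewrite [X in (X + _ <= _)%E]E1 [X in (_ + X <= _)%E]E2.
have -> : ('C(n.+1, k.+1)%:R * p ^+ k.+1)%:E =
    (p%:E * ('C(n, k)%:R * p ^+ k)%:E + ('C(n, k.+1)%:R * p ^+ k.+1)%:E)%E.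
  by rewrite -EFinM -EFinD; congr EFin; rewrite binS natrD exprS; ring.
apply: leeD; last exact: (IH k.+1).
by apply: lee_pmul => //; exact: (IH k).
Qed.

(** With k = ceil(m/2), C(m,k) <= 2^m <= 4^k; this is the origin of the factor 4 in the failure
    probability. *)
Lemma bin_uphalf_le (p : R) m : odd m -> 0 <= p ->
  'C(m, uphalf m)%:R * p ^+ uphalf m <= (4 * p) ^+ uphalf m.
Proof.
move=> om p0; rewrite exprMn ler_wpM2r ?exprn_ge0//.
rewrite -natrX ler_nat (_ : 4 = 2 ^ 2)%N// -expnM.
apply: (@leq_trans (2 ^ m)%N); last first.
  by rewrite leq_pexp2l//; have := odd_double_half m; rewrite uphalf_half om; lia.
have := expnDn 1 1 m; rewrite -[(1 + 1)%N]/2%N => ->.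
have um : (uphalf m < m.+1)%N by have := odd_double_half m; rewrite uphalf_half om; lia.
by rewrite (bigD1 (Ordinal um))//= !exp1n !muln1 leq_addr.
Qed.

End iid_tail.

Section median.
Variable R : realType.

(** If the median is farther than t from c, so are the entries beyond it: those from position n on
    when the median is at least c, the first n+1 otherwise. Either way these are n+1 = ceil(size/2)
    entries, the median included. *)
Lemma median_dist (s : seq R) (c t : R) :
  odd (size s) -> (count (fun x => t < `|x - c|)%R s < uphalf (size s))%N ->
  `|median s - c| <= t.
Proof.
move=> os cs; rewrite leNgt; apply/negP => lt_t.
have ss : sorted <=%R (sort <=%R s) by exact: sort_le_sorted.
have cE : count (fun x => t < `|x - c|)%R s = count (fun x => t < `|x - c|)%R (sort <=%R s).
  by apply/permP; rewrite perm_sym perm_sort.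
move: cs lt_t; rewrite cE -(size_sort <=%R s) /median -(size_sort <=%R s).
rewrite -(size_sort <=%R s) in os.
move: (sort _ _) os ss => {cE} u ou su.
set n := (size u)./2 => cu lt_t.
have nu : (n < size u)%N by have := odd_double_half (size u); rewrite ou -/n; lia.
have un : (uphalf (size u) = n.+1)%N by rewrite uphalf_half ou.
have szu : (size u = n.+1 + n)%N by have := odd_double_half (size u); rewrite ou -/n; lia.
have [cle|clt] := leP c u`_n.
  rewrite ger0_norm ?subr_ge0// in lt_t.
  suff : (n.+1 <= count (fun x => t < `|x - c|)%R u)%N by rewrite -un leqNgt cu.
  rewrite -(cat_take_drop n u) count_cat.
  suff /eqP -> : count (fun x => t < `|x - c|)%R (drop n u) == n.+1 by rewrite leq_addl.
  have <- : size (drop n u) = n.+1 by rewrite size_drop szu addnK.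
  rewrite -all_count; apply/(all_nthP 0) => i; rewrite size_drop => ilt.
  rewrite nth_drop (lt_le_trans lt_t)// (le_trans _ (ler_norm _))// lerD2r.
  apply: (sorted_leq_nth le_trans lexx 0 su); rewrite ?inE ?leq_addr//.
  by rewrite -ltn_subRL.
rewrite ltr0_norm ?subr_lt0// opprB in lt_t.
suff : (n.+1 <= count (fun x => t < `|x - c|)%R u)%N by rewrite -un leqNgt cu.
rewrite -(cat_take_drop n.+1 u) count_cat.
suff /eqP -> : count (fun x => t < `|x - c|)%R (take n.+1 u) == n.+1 by rewrite leq_addr.
have stake : size (take n.+1 u) = n.+1 by rewrite size_takel.
rewrite -[X in _ == X]stake -all_count; apply/(all_nthP 0) => i; rewrite stake => ilt.
rewrite nth_take// distrC (lt_le_trans lt_t)// (le_trans _ (ler_norm _))// lerD2l lerN2.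
by apply: (sorted_leq_nth le_trans lexx 0 su); rewrite ?inE// (leq_trans ilt).
Qed.
End median.

(** * Random generating vectors *)

Section generating_vectors.
Variables (R : realType) (d N : nat).
Hypothesis N_gt1 : (1 < N)%N.

(** A finite type for the admissible generating vectors, the index i standing for the entry i+1, so
    that probabilities over z become ratios of cardinals. *)
Definition gvec_index := {ffun 'I_d -> 'I_N.-1}.

Definition gvec (f : gvec_index) : d.-tuple nat := [tuple (f j).+1 | j < d].

Lemma gvec_inj : injective gvec.
Proof.
move=> f g fg; apply/ffunP => j; apply: val_inj; apply: succn_inj.
by have := congr1 (fun t => tnth t j) fg; rewrite !tnth_mktuple.
Qed.

Lemma generating_vectorsE : generating_vectors N = gvec @` [set: gvec_index].
Proof.
apply/seteqP; split => [z zG|_ [f _ <-] j]; last first.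
  by rewrite tnth_mktuple /= ltn_ord.
have zlt j : ((tnth z j).-1 < N.-1)%N.
  by have := zG j; case: (tnth z j) => //= n /andP[_]; rewrite ltnS.
exists [ffun j => Ordinal (zlt j)] => //; apply: eq_from_tnth => j.
by rewrite tnth_mktuple ffunE /= prednK//; have /andP[] := zG j.
Qed.

Lemma card_gvec_index_gt0 : (0 < #|gvec_index|)%N.
Proof. by rewrite card_ffun card_ord expn_gt0; case: N N_gt1 => [|[]]. Qed.

Lemma measurable_tuple_nat1 (z : d.-tuple nat) : measurable [set z].
Proof.
rewrite (_ : [set z] = \bigcap_(j in [set: 'I_d])
    (setT `&` (@tnth d nat ^~ j) @^-1` [set tnth z j])).
  by apply: fin_bigcap_measurable => // j _; exact: measurable_tnth.
apply/seteqP; split => [_ -> j _ //=|y /= yz].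
by apply: eq_from_tnth => j; have [] := yz j I.
Qed.

Lemma counting_generating_vectors (F : {set gvec_index}) :
  counting (gvec @` [set f | f \in F]) = #|F|%:R%:E :> \bar R.
Proof.
have -> : gvec @` [set f | f \in F] = [set` [fset gvec f | f in F]%fset].
  apply/seteqP; split => z /=; first by move=> [f fF <-]; apply/imfsetP; exists f.
  by move=> /imfsetP[f /= fF ->]; exists f.
rewrite /counting asboolT; last exact: finite_fset.
rewrite set_fsetK card_imfset//=; last exact: gvec_inj.
by rewrite cardE.
Qed.

Lemma uniform_generating_vectorE (F : {set gvec_index}) :
  uniform_generating_vector R d N (gvec @` [set f | f \in F]) =
  (#|F|%:R / #|gvec_index|%:R)%:E.
Proof.
have cG : counting (generating_vectors N : set (d.-tuple nat)) =
    #|gvec_index|%:R%:E :> \bar R.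
  rewrite generating_vectorsE -cardsT -counting_generating_vectors.
  by congr (counting (_ @` _)); apply/seteqP; split => f //= _; rewrite inE.
have evE : mrestr (@counting _ R) (@measurable_generating_vectors d N) [set: d.-tuple nat] =
    #|gvec_index|%:R%:E by rewrite /mrestr setTI.
(* [mnormalize] falls back on its default only for total mass 0 or infinity; here the mass is the
   positive number of admissible vectors. *)
pose c : \bar R := mrestr (@counting _ R) (@measurable_generating_vectors d N) [set: d.-tuple nat].
have -> A : uniform_generating_vector R d N A =
    ((if (c == 0) || (c == +oo) then \d_[tuple 1%N | _ < d]
     else fun B => mrestr (@counting _ R) (@measurable_generating_vectors d N) B * (fine c)^-1%:E) A)%E.
  by [].
rewrite /c evE.
have G0 := card_gvec_index_gt0.
rewrite orbF eqe pnatr_eq0 gt_eqF// EFinM; congr (_ * _)%E.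
rewrite -counting_generating_vectors; congr counting.
rewrite generating_vectorsE; apply/seteqP; split => [z []//|z /= [f fF <-]].
by split; exists f.
Qed.

Lemma uniform_generating_vectorC :
  uniform_generating_vector R d N (~` generating_vectors N) = 0%E.
Proof.
rewrite probability_setC; last exact: measurable_generating_vectors.
rewrite generating_vectorsE (_ : [set: gvec_index] = [set f | f \in [set: gvec_index]%SET]).
  rewrite uniform_generating_vectorE cardsT divff ?subee//.
  by rewrite pnatr_eq0 -lt0n card_gvec_index_gt0.
by apply/seteqP; split => f //= _; rewrite inE.
Qed.

(* Everything outside the support of the law of z is included, so that a point
   outside this set has an admissible z. *)
Definition gvec_fiber (Y : Type) (D : gvec_index -> set Y) : set (d.-tuple nat * Y) :=
  (\big[setU/set0]_f ([set gvec f] `*` D f)) `|` (~` generating_vectors N) `*` setT.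

Lemma measurable_gvec_fiber dY (Y : measurableType dY) (D : gvec_index -> set Y) :
  (forall f, measurable (D f)) -> measurable (gvec_fiber D).
Proof.
move=> mD; apply: measurableU.
  apply: bigsetU_measurable => f _; apply: measurableX => //.
  exact: measurable_tuple_nat1.
apply: measurableX => //; apply: measurableC; exact: measurable_generating_vectors.
Qed.

(** A union bound over the rectangles, on each of which the product law factors; the part outside
    the support of z is null. *)
Lemma uniform_gvec_fiber dY (Y : measurableType dY) (Q : probability Y R)
    (D : gvec_index -> set Y) : (forall f, measurable (D f)) ->
  ((uniform_generating_vector R d N \x Q) (gvec_fiber D) <=
   \sum_f ((#|gvec_index|%:R^-1)%:E * Q (D f)))%E.
Proof.
move=> mD; set U := uniform_generating_vector R d N.
have mf f : measurable ([set gvec f] `*` D f).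
  by apply: measurableX => //; exact: measurable_tuple_nat1.
have mC : measurable (~` generating_vectors N : set (d.-tuple nat)).
  by apply: measurableC; exact: measurable_generating_vectors.
pose V : {measure set (d.-tuple nat * Y) -> \bar R} := (U \x Q)%E.
have VE A B : measurable A -> measurable B -> V (A `*` B) = (U A * Q B)%E.
  exact: product_measure1E.
rewrite -[leLHS]/(V _).
have VC : V (~` generating_vectors N `*` setT) = 0%E.
  by rewrite VE// uniform_generating_vectorC mul0e.
apply: (le_trans (measureU2 _ _ _)).
- exact: bigsetU_measurable.
- exact: measurableX.
rewrite [X in (_ + X <= _)%E]VC adde0.
have U1 f : U [set gvec f] = (#|gvec_index|%:R^-1)%:E.
  have -> : [set gvec f] = gvec @` [set g | g \in [set f]%SET].
    apply/seteqP; split => z /=; first by move=> ->; exists f => //; rewrite inE.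
    by move=> [g]; rewrite inE => /eqP -> <-.
  by rewrite uniform_generating_vectorE cards1 mul1r.
have [_] := measure_bigsetU_le V (s := index_enum _) (fun f _ => mf f).
move/le_trans; apply; apply: lee_sum => f _.
by rewrite -(U1 f) -VE//; exact: measurable_tuple_nat1.
Qed.

Definition gvec_dot (k : 'I_d -> int) (f : gvec_index) : int :=
  \sum_j k j * (f j).+1%:Z.

(** Overwriting the coordinate j0 by an arbitrary value is injective on solutions: two solutions
    that agree off j0 differ there by a multiple of the prime N, which does not divide k_j0, and
    both values lie in {1, ..., N-1}. *)
Lemma card_congruent (k : 'I_d -> int) j0 : prime N -> ~~ (N%:Z %| k j0)%Z ->
  (#|[set f : gvec_index | (N%:Z %| gvec_dot k f)%Z]%SET| * N.-1 <= #|gvec_index|)%N.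
Proof.
move=> Np Nk; pose S := [set f : gvec_index | (N%:Z %| gvec_dot k f)%Z]%SET; rewrite -/S.
pose phi (x : gvec_index * 'I_N.-1) : gvec_index :=
  [ffun j => if j == j0 then x.2 else x.1 j].
have -> : (#|S| * N.-1)%N = #|finset.setX S [set: 'I_N.-1]%SET|.
  by rewrite cardsX cardsT card_ord.
rewrite -(card_in_imset (f := phi)); first exact: max_card.
move=> [f a] [g b]; rewrite !inE /= !andbT => fS gS /ffunP fg.
have ab : a = b by have := fg j0; rewrite !ffunE eqxx.
have fgj j : j != j0 -> f j = g j.
  by move=> jj0; have := fg j; rewrite !ffunE (negbTE jj0).
congr pair => //; apply/ffunP => j; have [->|/fgj//] := eqVneq j j0.
have := rpredB fS gS; rewrite -sumrB (bigD1 j0)//= big1 => [|i /fgj ->]; last by rewrite subrr.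
rewrite addr0 -mulrBr Gauss_dvdzr; last first.
  by rewrite /coprimez /gcdz /= -[_ == _]/(coprime N _) prime_coprime// -dvdzE.
rewrite dvdzE /= => dv; apply: val_inj => /=.
have [/eqP|gt0] := posnP `|(f j0).+1%:Z - (g j0).+1%:Z|%N.
  by rewrite absz_eq0 subr_eq0 eqz_nat eqSS => /eqP.
have := dvdn_leq gt0 dv; have := ltn_ord (f j0); have := ltn_ord (g j0); lia.
Qed.

End generating_vectors.

Import ComplexField.Normc.

(** * Bessel's inequality on the cube *)

Section orthogonality.
Context {R : realType}.

Lemma cos_periodZ (k : int) (t : R) : cos (2 * pi * k%:~R + t) = cos t.
Proof.
have cn (n : nat) (u : R) : cos (2 * pi * n%:R + u) = cos u.
  have <- := periodicn (@cosD2pi R) n u.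
  by congr cos; rewrite -[pi *+ 2 *+ n]mulr_natr -[pi *+ 2]mulr_natr; ring.
case: k => n; first exact: cn.
rewrite -[LHS](cn n.+1); congr cos; rewrite NegzE mulrNz; ring.
Qed.

Lemma sin_periodZ (k : int) (t : R) : sin (2 * pi * k%:~R + t) = sin t.
Proof. by rewrite -!cosBpihalf -addrA cos_periodZ. Qed.

Lemma integral_cos_uniform (k : int) (c : R) : k != 0 ->
  (\int[uniform_prob (@ltr01 R)]_x (1 + cos (2 * pi * (k%:~R * x) + c))%:E = 1)%E.
Proof.
move=> k0; set w : R := 2 * pi * k%:~R.
have pi0 : pi != 0 :> R by rewrite gt_eqF// pi_gt0.
have w0 : w != 0 by rewrite /w !mulf_neq0// intr_eq0.
(* [F] is an antiderivative of [f]; its sine part is equal at 0 and 1 because w is a multiple of 2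
   pi. *)
pose f x := 1 + cos (w * x + c); pose F x := x + w^-1 * sin (w * x + c).
have dF (x : R) : is_derive x 1 F (f x).
  have d1 : is_derive x 1 (fun y : R => w * y + c) w.
    have := is_deriveD (is_deriveZ w (is_derive_id x 1)) (is_derive_cst c x 1).
    by rewrite addr0 /GRing.scale/= mulr1.
  have d2 := @is_derive1_comp R sin (fun y : R => w * y + c) x _ _ (is_derive_sin _) d1.
  have := is_deriveD (is_derive_id x 1) (is_deriveZ w^-1 d2).
  by rewrite /GRing.scale/= mulrCA mulVf// mulr1.
have cf : continuous f.
  move=> x; apply: continuousD; first exact: cvg_cst.
  apply: (@continuous_comp _ _ _ (fun y : R => w * y + c) cos); last exact: continuous_cos.
  apply: continuousD; last exact: cvg_cst.
  by apply: continuousM; [exact: cvg_cst|exact: cvg_id].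
under eq_integral do rewrite mulrA -/w -/(f _).
rewrite integral_uniform; last 2 first.
- by apply/measurable_EFinP; exact: continuous_measurable_fun.
- by move=> x; rewrite lee_fin /f -lerBlDl sub0r cos_geN1.
rewrite subr0 invr1 mul1e (@continuous_FTC2 _ f F)//.
- rewrite -EFinB /F mulr1 mulr0 add0r; congr EFin.
  by rewrite sin_periodZ add0r addrK.
- exact: continuous_subspaceT.
- have cF : continuous F.
    by move=> x; apply/differentiable_continuous/derivable1_diffP; exact: ex_derive.
  split => [x _||]; first exact: ex_derive.
  + exact/cvg_at_right_filter/cF.
  + exact/cvg_at_left_filter/cF.
- by move=> x _; rewrite derive1E; apply: derive_val.
Qed.

Lemma measurable_dot d (h : d.-tuple int) :
  measurable_fun setT (fun x : vec R d => dot h x).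
Proof.
apply: measurable_sum => j; apply: measurable_funM; first exact: measurable_cst.
exact: measurable_tnth.
Qed.

Lemma dot_cons d (k : int) (h : d.-tuple int) (x : measurableTypeR R) (t : vec R d) :
  dot [tuple of k :: h] [tuple of x :: t] = k%:~R * (x : R) + dot h t.
Proof.
rewrite /dot big_ord_recl !tnth0; congr (_ + _); apply: eq_bigr => j _.
by rewrite !tnthS.
Qed.

Lemma measurable_cos_dot d (h : d.-tuple int) (c : R) :
  measurable_fun setT (fun x : vec R d => (1 + cos (2 * pi * dot h x + c))%:E).
Proof.
apply/measurable_EFinP; apply: measurable_funD; first exact: measurable_cst.
apply: (@measurableT_comp _ _ _ _ _ _ cos).
  by apply: continuous_measurable_fun; exact: continuous_cos.
apply: measurable_funD; last exact: measurable_cst.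
by apply: measurable_funM; [exact: measurable_cst|exact: measurable_dot].
Qed.

(* The phase c makes the induction on d go through; adding 1 makes the integrand
   nonnegative, so that Tonelli applies. *)
Lemma integral_1Dcos_cube d (h : d.-tuple int) (c : R) :
  h != [tuple 0 | _ < d] ->
  (\int[cube_measure R d]_x (1 + cos (2 * pi * dot h x + c))%:E = 1)%E.
Proof.
have ge0 (u : R) : (0 <= (1 + cos u)%:E)%E.
  by rewrite lee_fin -lerBlDl sub0r cos_geN1.
elim: d h c => [|d IH] h c h0.
  by move/negP : h0; case; apply/eqP; rewrite [h]tuple0 [RHS]tuple0.
case/tupleP: h h0 => k h kh0.
rewrite /cube_measure /= -/(cube_measure R d).
rewrite ge0_integral_pushforward//=; last exact: measurable_cos_dot.
rewrite fubini_tonelli1//=; last first.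
  apply: (measurableT_comp (measurable_cos_dot _ c)); exact: measurable_tcons.
rewrite /fubini_F /=.
have key x t : 2 * pi * dot [tuple of k :: h] (tcons (x, t)) + c =
    2 * pi * dot h t + (2 * pi * (k%:~R * x) + c).
  by rewrite dot_cons /= mulrDr addrAC addrC.
under eq_integral => x _ do under eq_integral => t _ do rewrite key.
(* If the remaining frequencies are not all zero, the induction hypothesis makes the inner integral
   1 for every [x], with 2 pi k x absorbed in the phase; otherwise the integrand depends on the
   first coordinate only. *)
have [h0|/IH hn0] := eqVneq h [tuple 0 | _ < d]; last first.
  under eq_integral do rewrite hn0.
  by rewrite integral_cst// mul1e; exact: probability_setT.
have k0 : k != 0.
  apply: contra kh0 => /eqP ->; apply/eqP/eq_from_tnth => j; rewrite tnth_mktuple h0.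
  by case: (unliftP ord0 j) => [j' ->|->]; rewrite ?tnthS ?tnth0 ?tnth_mktuple.
rewrite -[RHS](integral_cos_uniform c k0); apply: eq_integral => x _.
have dot0 t : dot h t = 0.
  by rewrite h0 /dot big1// => j _; rewrite tnth_mktuple mul0r.
under eq_integral do rewrite dot0 mulr0 add0r.
rewrite integral_cst// -[RHS]mule1; congr (_ * _)%E; exact: probability_setT.
Qed.

Lemma integrable_cos_dot d (h : d.-tuple int) (c : R) :
  (cube_measure R d).-integrable setT (fun x => (cos (2 * pi * dot h x + c))%:E).
Proof.
apply: measurable_bounded_integrable => //.
- by apply: le_lt_trans (ltry 1); exact: probability_le1.
- have := measurable_cos_dot h c => /measurable_EFinP m1.
  have := measurable_funB m1 (measurable_cst (1 : R)).
  by apply: eq_measurable_fun => x _ /=; rewrite addrAC subrr add0r.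
- exists 1; split => // M M1 x _ /=; apply: le_trans (ltW M1).
  by rewrite ler_norml cos_geN1 cos_le1.
Qed.

Lemma integral_cos_cube d (h : d.-tuple int) (c : R) : h != [tuple 0 | _ < d] ->
  (\int[cube_measure R d]_x (cos (2 * pi * dot h x + c))%:E = 0)%E.
Proof.
move=> h0; have := integral_1Dcos_cube c h0.
have i1 : (cube_measure R d).-integrable setT (EFin \o (fun=> 1 : R)).
  exact: finite_measure_integrable_cst.
under eq_integral do rewrite EFinD.
rewrite integralD//; last exact: integrable_cos_dot.
rewrite integral_cst// mul1e [X in (X + _ = _)%E]probability_setT.
case: (\int[_]_x _)%E => [r| |] //= [] r1.
by congr EFin; lra.
Qed.

Lemma sinE_cos (t : R) : sin t = cos (t + - (pi / 2)).
Proof. by rewrite cosBpihalf. Qed.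

Lemma integrable_trig_term d (h : d.-tuple int) (u v : R) :
  (cube_measure R d).-integrable setT
    (fun x => (u * cos (2 * pi * dot h x) - v * sin (2 * pi * dot h x))%:E).
Proof.
have ic : (cube_measure R d).-integrable setT (fun x => (cos (2 * pi * dot h x))%:E).
  by apply: eq_integrable (integrable_cos_dot h 0) => // x _; rewrite addr0.
have is_ : (cube_measure R d).-integrable setT (fun x => (sin (2 * pi * dot h x))%:E).
  by apply: eq_integrable (integrable_cos_dot h (- (pi / 2))) => // x _; rewrite sinE_cos.
under eq_fun do rewrite EFinB !EFinM.
by apply: integrableB => //; exact: integrableZl.
Qed.

(** The integrand is the real part of (u + i v) exp(2 pi i h.x), so this is the orthogonality of
    characters in real form. *)
Lemma integral_trig_term d (h : d.-tuple int) (u v : R) :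
  (\int[cube_measure R d]_x
    (u * cos (2 * pi * dot h x) - v * sin (2 * pi * dot h x))%:E =
   (if h == [tuple 0 | _ < d] then u else 0)%:E)%E.
Proof.
case: eqVneq => [->|h0].
  have dot0 (t : vec R d) : dot [tuple 0 | _ < d] t = 0.
    by rewrite /dot big1// => j _; rewrite tnth_mktuple mul0r.
  under eq_integral do rewrite dot0 mulr0 sin0 cos0 mulr0 mulr1 subr0.
  by rewrite integral_cst// -[RHS]mule1; congr (_ * _)%E; exact: probability_setT.
have ic : (cube_measure R d).-integrable setT (fun x => (cos (2 * pi * dot h x))%:E).
  by apply: eq_integrable (integrable_cos_dot h 0) => // x _; rewrite addr0.
have is_ : (cube_measure R d).-integrable setT (fun x => (sin (2 * pi * dot h x))%:E).
  by apply: eq_integrable (integrable_cos_dot h (- (pi / 2))) => // x _; rewrite sinE_cos.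
under eq_integral do rewrite EFinB !EFinM.
rewrite integralB//; [|exact: integrableZl|exact: integrableZl].
rewrite !integralZl//.
have -> : (\int[cube_measure R d]_x (cos (2 * pi * dot h x))%:E = 0)%E.
  by rewrite -[RHS](integral_cos_cube 0 h0); under [RHS]eq_integral do rewrite addr0.
have -> : (\int[cube_measure R d]_x (sin (2 * pi * dot h x))%:E = 0)%E.
  by rewrite -[RHS](integral_cos_cube (- (pi / 2)) h0); under eq_integral do rewrite sinE_cos.
by rewrite !mule0 sube0.
Qed.
End orthogonality.

Section complex_exponential.
Context {R : realType}.
Implicit Types (s t : R) (z w : R[i]).

Lemma expi2piD s t : expi2pi (s + t) = expi2pi s * expi2pi t.
Proof. by rewrite /expi2pi mulrDr cosD sinD; simpc; congr Complex; ring. Qed.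

Lemma expi2pi_conj t : conjc (expi2pi t) = expi2pi (- t).
Proof. by rewrite /expi2pi mulrN cosN sinN; simpc. Qed.

Lemma expi2piDint t (k : int) : expi2pi (t + k%:~R) = expi2pi t.
Proof. by rewrite /expi2pi mulrDr addrC cos_periodZ sin_periodZ. Qed.

Lemma expi2pi0 : expi2pi (0 : R) = 1.
Proof. by rewrite /expi2pi mulr0 cos0 sin0. Qed.

Lemma normc_expi2pi t : normc (expi2pi t) = 1.
Proof. by rewrite /expi2pi /= cos2Dsin2 sqrtr1. Qed.

Lemma sqr_normcE z : normc z ^+ 2 = complex.Re z ^+ 2 + complex.Im z ^+ 2.
Proof. by case: z => a b /=; rewrite sqr_sqrtr// addr_ge0 ?sqr_ge0. Qed.

Lemma sqr_normc_Re z : normc z ^+ 2 = complex.Re (z * conjc z).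
Proof. by rewrite sqr_normcE; case: z => a b; simpc => /=; ring. Qed.

Lemma normc_ge0 z : 0 <= normc z. Proof. by case: z => a b /=; exact: sqrtr_ge0. Qed.

Lemma ler_normc_sum (I : Type) (r : seq I) (P : pred I) (F : I -> R[i]) :
  normc (\sum_(i <- r | P i) F i) <= \sum_(i <- r | P i) normc (F i).
Proof.
elim/big_ind2: _ => // [|x1 x2 y1 y2 h1 h2]; first by rewrite normc0.
by apply: le_trans (le_normcD _ _) _; exact: lerD.
Qed.

Lemma conjcM z w : conjc (z * w) = conjc z * conjc w.
Proof. by case: z w => [a b] [c e]; simpc; congr Complex; ring. Qed.

Lemma conjc_sum (I : Type) (r : seq I) (F : I -> R[i]) :
  conjc (\sum_(i <- r) F i) = \sum_(i <- r) conjc (F i).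
Proof.
apply: (big_morph (@conjc R)) => [z w|]; last by rewrite /= oppr0.
by case: z w => [a b] [c e]; simpc; congr Complex; ring.
Qed.

Lemma Re_sum (I : Type) (r : seq I) (F : I -> R[i]) :
  complex.Re (\sum_(i <- r) F i) = \sum_(i <- r) complex.Re (F i).
Proof. exact: raddf_sum. Qed.

Lemma normc_dist (z w : R[i]) : `|normc z - normc w| <= normc (z - w).
Proof.
have dist (u v : R[i]) : normc u - normc v <= normc (u - v).
  by rewrite lerBlDr -{1}(subrK v u) le_normcD.
rewrite ler_norml; apply/andP; split; last exact: dist.
by rewrite lerNl opprB -[z - w]opprB normcN; exact: dist.
Qed.

Lemma Re_dist (u v : R[i]) : `|complex.Re u - complex.Re v| <= normc (u - v).
Proof.
rewrite -ler_sqr ?nnegrE ?normc_ge0// sqr_normcE -normrX.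
by case: u v => [a b] [a' b'] /=; rewrite ger0_norm ?sqr_ge0// lerDl sqr_ge0.
Qed.

Lemma Im_dist (u v : R[i]) : `|complex.Im u - complex.Im v| <= normc (u - v).
Proof.
rewrite -ler_sqr ?nnegrE ?normc_ge0// sqr_normcE -normrX.
by case: u v => [a b] [a' b'] /=; rewrite ger0_norm ?sqr_ge0// lerDr sqr_ge0.
Qed.
End complex_exponential.

Section bessel.
Context {R : realType} {d : nat}.
Implicit Types (h l : d.-tuple int) (x : vec R d) (a : d.-tuple int -> R[i]).

Definition subt h l : d.-tuple int := [tuple tnth h j - tnth l j | j < d].

Lemma dot_subt h l x : dot (subt h l) x = dot h x - dot l x.
Proof.
rewrite /dot -sumrB; apply: eq_bigr => j _.
by rewrite tnth_mktuple rmorphB mulrBl.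
Qed.

Lemma subt_eq0 h l : (subt h l == [tuple 0 | _ < d]) = (h == l).
Proof.
apply/eqP/eqP => [/(congr1 (fun t => tnth t _)) hl|->]; apply: eq_from_tnth => j.
  by apply/eqP; rewrite -subr_eq0; have := hl j; rewrite !tnth_mktuple => ->.
by rewrite !tnth_mktuple subrr.
Qed.

Definition trig_poly a (s : seq (d.-tuple int)) x : R[i] :=
  \sum_(h <- s) a h * expi2pi (dot h x).

Lemma sqr_normc_trig_poly a s x : normc (trig_poly a s x) ^+ 2 =
  \sum_(h <- s) \sum_(l <- s)
    (complex.Re (a h * conjc (a l)) * cos (2 * pi * dot (subt h l) x) -
     complex.Im (a h * conjc (a l)) * sin (2 * pi * dot (subt h l) x)).
Proof.
rewrite sqr_normc_Re /trig_poly.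
rewrite conjc_sum mulr_suml Re_sum; apply: eq_bigr => h _.
rewrite mulr_sumr Re_sum; apply: eq_bigr => l _.
rewrite conjcM expi2pi_conj mulrACA -expi2piD -dot_subt /expi2pi.
by case: (a h * conjc (a l)) => u v; simpc.
Qed.

(** Parseval's identity: the off-diagonal terms of the double sum have mean 0. *)
Lemma integral_trig_poly a s : uniq s ->
  (\int[cube_measure R d]_x (normc (trig_poly a s x) ^+ 2)%:E =
   (\sum_(h <- s) normc (a h) ^+ 2)%:E)%E.
Proof.
move=> us; under eq_integral do rewrite sqr_normc_trig_poly -sumEFin.
rewrite integral_sum//; last first.
  move=> h; under eq_fun do rewrite -sumEFin.
  by apply: integrable_sum => // l _; exact: integrable_trig_term.
rewrite -sumEFin big_seq [RHS]big_seq; apply: eq_bigr => h hs.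
under eq_integral do rewrite -sumEFin.
rewrite integral_sum//; last by move=> l; exact: integrable_trig_term.
rewrite (bigD1_seq h)//= big1_seq ?adde0 => [|l /andP[lh _]].
  by rewrite integral_trig_term subt_eq0 eqxx sqr_normc_Re.
by rewrite integral_trig_term subt_eq0 eq_sym (negbTE lh).
Qed.

Lemma normc_trig_term (b : R[i]) h x : normc (b * expi2pi (dot h x)) = normc b.
Proof. by rewrite normcM normc_expi2pi mulr1. Qed.

Lemma measurable_sqr_normc_trig_poly a s :
  measurable_fun setT (fun x => normc (trig_poly a s x) ^+ 2).
Proof.
apply: eq_measurable_fun => [x _|]; first by rewrite sqr_normc_trig_poly.
apply: measurable_sum => h; apply: measurable_sum => l.
apply/measurable_EFinP; exact: measurable_int (integrable_trig_term _ _ _).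
Qed.

Section has_sum_trig.
Variables (a : d.-tuple int -> R[i]) (g : vec R d -> R[i]).
Hypothesis a_summable : (\esum_(h in [set: d.-tuple int]) (normc (a h))%:E < +oo)%E.
Hypothesis g_sum : forall x, has_sum (fun h => a h * expi2pi (dot h x)) (g x).

(** The terms have modulus |a_h| whatever [x] is, so one [F] serves all [x]. *)
Lemma trig_poly_approx (e : R) : 0 < e ->
  exists F : {fset d.-tuple int}, forall x, normc (g x - trig_poly a F x) <= e.
Proof.
move=> e0; have [F HF] := esum_approx (fun h => normc_ge0 (a h)) a_summable e0.
exists F => x; apply/ler_addgt0Pr => n n0.
have [A0 HA] := g_sum x n0.
(* The set [A0] given by convergence at [x] depends on [x]; it is joined with [F], and the terms it
   adds have total modulus at most [e]. *)
have FA : (F `<=` A0 `|` F)%fset by exact: fsubsetUr.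
have := HA _ (fsubsetUl A0 F).
set S := \sum_(i <- _) _ => lt.
have -> : g x - trig_poly a F x = (S - trig_poly a F x) - (S - g x) by ring.
apply: le_trans (le_normcD _ _) _; rewrite normcN lerD ?(ltW lt)//.
rewrite /S (sum_fset_split _ FA) addrAC subrr add0r.
apply: le_trans (ler_normc_sum _ _ _) _.
under eq_bigr do rewrite normc_trig_term.
by have := HF (A0 `|` F)%fset; rewrite (sum_fset_split _ FA) lerD2l.
Qed.

Let S := fine (\esum_(h in [set: d.-tuple int]) (normc (a h))%:E).

Lemma normc_trig_poly_le (F : {fset d.-tuple int}) x : normc (trig_poly a F x) <= S.
Proof.
apply: le_trans (ler_normc_sum _ _ _) _; under eq_bigr do rewrite normc_trig_term.
rewrite -lee_fin fineK; first by apply: sum_fset_le_esum => h; exact: normc_ge0.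
by rewrite ge0_fin_numE// esum_ge0// => h _; rewrite lee_fin normc_ge0.
Qed.

Lemma measurable_sqr_normc_has_sum : measurable_fun setT (fun x => normc (g x) ^+ 2).
Proof.
have pos (n : nat) : 0 < (n.+1%:R : R)^-1 by rewrite invr_gt0.
have [F HF] := choice (fun n => trig_poly_approx (pos n)).
apply: (measurable_fun_cvg (h := fun n x => normc (trig_poly a (F n) x) ^+ 2)).
  by move=> n; exact: measurable_sqr_normc_trig_poly.
move=> x _.
suff cx : normc (trig_poly a (F n) x) @[n --> \oo] --> normc (g x) by exact: cvgM.
apply/cvgrPdist_le => e e0; near=> n.
apply: le_trans (normc_dist _ _) _; apply: le_trans (HF n x) _.
apply: ltW; near: n; exact: (near_infty_natSinv_lt (PosNum e0)).
Unshelve. all: by end_near. Qed.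

Lemma bessel :
  (\int[cube_measure R d]_x (normc (g x) ^+ 2)%:E <=
   \esum_(h in [set: d.-tuple int]) (normc (a h) ^+ 2)%:E)%E.
Proof.
have S0 : 0 <= S by rewrite fine_ge0// esum_ge0// => h _; rewrite lee_fin normc_ge0.
apply/lee_addgt0Pr => e' e'0.
(* With |p| <= S, squaring |g| <= |p| + e costs 2 S e + e^2 <= (2 S + 1) e <= e', where e <= 1 gives
   e^2 <= e. *)
pose e := Num.min 1 (e' / (2 * S + 1)).
have S1 : 0 < 2 * S + 1 by rewrite ltr_wpDl ?mulr_ge0.
have e0 : 0 < e by rewrite lt_min ltr01 divr_gt0.
have [F HF] := trig_poly_approx e0.
have le2 x : normc (g x) ^+ 2 <= normc (trig_poly a F x) ^+ 2 + e'.
  have gle : normc (g x) <= normc (trig_poly a F x) + e.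
    by rewrite -lerBlDl; apply: le_trans (ler_norm _) _; apply: le_trans (normc_dist _ _) _.
  apply: (@le_trans _ _ ((normc (trig_poly a F x) + e) ^+ 2)).
    by rewrite ler_sqr ?nnegrE ?addr_ge0 ?normc_ge0// ltW.
  rewrite sqrrD -addrA lerD2l -mulrnAl.
  apply: (@le_trans _ _ (e * (2 * S + 1))); last first.
    by rewrite -ler_pdivlMr// ge_min lexx orbT.
  rewrite mulrDr lerD//; last by rewrite expr2 ler_wpM2l ?(ltW e0)// ge_min lexx.
  rewrite mulrC ler_wpM2l ?(ltW e0)// -mulr_natl ler_wpM2l//.
  exact: normc_trig_poly_le.
apply: (@le_trans _ _ (\int[cube_measure R d]_x (normc (trig_poly a F x) ^+ 2 + e')%:E)%E).
  apply: ge0_le_integral => //.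
  - by move=> x _; rewrite lee_fin sqr_ge0.
  - by apply/measurable_EFinP; exact: measurable_sqr_normc_has_sum.
  - apply/measurable_EFinP; apply: measurable_funD; last exact: measurable_cst.
    exact: measurable_sqr_normc_trig_poly.
  - by move=> x _; rewrite lee_fin.
under eq_integral do rewrite EFinD.
rewrite ge0_integralD//; last 3 first.
- by move=> x _; rewrite lee_fin sqr_ge0.
- by apply/measurable_EFinP; exact: measurable_sqr_normc_trig_poly.
- by move=> x _; rewrite lee_fin ltW.
rewrite (integral_trig_poly _ (fset_uniq F)) [X in (_ + X <= _)%E](_ : _ = e'%:E); last first.
  by rewrite -[RHS]mule1 -(probability_setT (cube_measure R d)); exact: integral_cst.
by apply: leeD2r; apply: sum_fset_le_esum => h; exact: sqr_ge0.
Qed.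
End has_sum_trig.
End bessel.

(** * Unordered sums of complex families *)

Section has_sum.
Context {R : realType} {I : choiceType}.
Implicit Types (u v : I -> R[i]) (s t : R[i]).

Lemma has_sumD u v s t : has_sum u s -> has_sum v t ->
  has_sum (fun i => u i + v i) (s + t).
Proof.
move=> us vt e e0; have e20 : 0 < e / 2 by rewrite divr_gt0.
have [A uA] := us _ e20; have [B vB] := vt _ e20; exists (A `|` B)%fset => C ABC.
rewrite big_split opprD addrACA; apply: le_lt_trans (le_normcD _ _) _.
rewrite (splitr e) ltrD ?uA ?vB// (fsubset_trans _ ABC)//.
  exact: fsubsetUl.
exact: fsubsetUr.
Qed.

Lemma has_sumZ (c : R[i]) u s : has_sum u s -> has_sum (fun i => c * u i) (c * s).
Proof.
move=> us e e0; have [->|c0] := eqVneq c 0.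
  exists fset0 => A _; under eq_bigr do rewrite mul0r.
  by rewrite big1 // mul0r subrr normc0.
have nc0 : 0 < normc c.
  by rewrite lt_neqAle normc_ge0 andbT eq_sym; apply: contra c0 => /eqP/eq0_normc ->.
have [A uA] := us _ (divr_gt0 e0 nc0); exists A => B AB.
by rewrite -mulr_sumr -mulrBr normcM mulrC -ltr_pdivlMr// uA.
Qed.

Lemma has_sum0 : has_sum (fun _ : I => 0 : R[i]) 0.
Proof. by move=> e e0; exists fset0 => A _; rewrite big1// subrr normc0. Qed.

Lemma has_sum_sum (J : Type) (r : seq J) (u : J -> I -> R[i]) (s : J -> R[i]) :
  (forall j, has_sum (u j) (s j)) ->
  has_sum (fun i => \sum_(j <- r) u j i) (\sum_(j <- r) s j).
Proof.
move=> us; elim: r => [|j r IH].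
  by rewrite big_nil (_ : (fun _ => _) = fun=> 0)//; [exact: has_sum0|apply/funext => i; rewrite big_nil].
rewrite big_cons (_ : (fun _ => _) = fun i => u j i + \sum_(j <- r) u j i).
  exact: has_sumD.
by apply/funext => i; rewrite big_cons.
Qed.

Lemma has_sum1 (h : I) (v : R[i]) : has_sum (fun i => if i == h then v else 0) v.
Proof.
move=> e e0; exists [fset h]%fset => A; rewrite fsub1set => hA.
rewrite (big_fsetD1 h)//= eqxx big_seq big1 ?addr0 ?subrr ?normc0// => i.
by rewrite !inE => /andP[/negbTE ->].
Qed.

Lemma has_sum_uniq u s t : has_sum u s -> has_sum u t -> s = t.
Proof.
move=> us ut; apply/eqP; rewrite -subr_eq0; apply/eqP; apply: eq0_normc.
apply/eqP; rewrite eq_le normc_ge0 andbT; apply/ler_addgt0Pr => e e0; rewrite add0r.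
have e20 : 0 < e / 2 by rewrite divr_gt0.
have [A uA] := us _ e20; have [B uB] := ut _ e20.
set C := (A `|` B)%fset.
have -> : s - t = - (\sum_(i <- C) u i - s) + (\sum_(i <- C) u i - t) by ring.
apply: le_trans (le_normcD _ _) _; rewrite (splitr e) normcN lerD// ltW//.
  by apply: uA; exact: fsubsetUl.
by apply: uB; exact: fsubsetUr.
Qed.

Lemma eq_has_sum u v s : u =1 v -> has_sum u s -> has_sum v s.
Proof. by move=> /funext ->. Qed.
End has_sum.

(** * Aliasing *)

Section lattice.
Context {R : realType}.

Lemma expi2pi_int (k : int) : expi2pi (k%:~R : R) = 1.
Proof. by rewrite -[k%:~R]add0r expi2piDint expi2pi0. Qed.

Lemma expi2piX (t : R) n : expi2pi t ^+ n = expi2pi (n%:R * t).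
Proof.
elim: n => [|n IH]; first by rewrite expr0 mul0r expi2pi0.
by rewrite exprS IH -expi2piD -[in RHS]natr1 mulrDl mul1r addrC.
Qed.

(** The value 1 would give cos(2 pi t) = 1, hence sin(pi t) = 0, although 0 < pi t < pi. *)
Lemma expi2pi_neq1 (t : R) : 0 < t < 1 -> expi2pi t != 1.
Proof.
move=> /andP[t0 t1]; apply/eqP; rewrite /expi2pi => -[+ _].
rewrite (_ : 2 * pi * t = (pi * t) *+ 2); last by rewrite mulr2n; ring.
rewrite cos_mulr2n mulr2n => c1.
have s0 : 0 < sin (pi * t).
  by rewrite sin_gt0_pi// mulr_gt0 ?pi_gt0//= -[ltRHS]mulr1 ltr_pM2l ?pi_gt0.
have := cos2Dsin2 (pi * t); have : 0 < sin (pi * t) ^+ 2 by rewrite exprn_gt0.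
move: c1; set c := cos _ ^+ 2; set s := sin _ ^+ 2; lra.
Qed.

(** A geometric sum with ratio w = exp(2 pi i q / N), where w^N = 1 and w = 1 only if N divides
    q. *)
Lemma character_sum (N : nat) (q : int) : (0 < N)%N ->
  N%:R^-1 * \sum_(k < N) expi2pi (k%:R * (q%:~R / N%:R) : R) =
  (if (N%:Z %| q)%Z then 1 else 0 : R[i]).
Proof.
move=> N0; have N0' : (N%:R : R) != 0 by rewrite pnatr_eq0 -lt0n.
have N0'' : (N%:R : R[i]) != 0 by rewrite pnatr_eq0 -lt0n.
case: ifPn => [/dvdzP[b ->]|Nq].
  under eq_bigr => k _.
    rewrite rmorphM /= -[N%:Z%:~R]/(N%:R) mulfK//.
    rewrite -[k%:R]/((Posz k)%:~R) -rmorphM /= expi2pi_int; over.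
  by rewrite sumr_const card_ord mulVf.
set w := expi2pi (q%:~R / N%:R : R).
have -> : \sum_(k < N) expi2pi (k%:R * (q%:~R / N%:R) : R) = \sum_(k < N) w ^+ k.
  by apply: eq_bigr => k _; rewrite expi2piX.
have wN : w ^+ N - 1 = 0.
  by rewrite expi2piX mulrC divfK// expi2pi_int subrr.
have w1 : w - 1 != 0.
  (* Replacing q by its remainder mod N leaves w unchanged and puts the angle into (0, 1). *)
  rewrite subr_eq0 /w (divz_eq q N) rmorphD rmorphM /= mulrDl mulfK// addrC.
  rewrite expi2piDint; apply: expi2pi_neq1.
  have NZ : N%:Z != 0 by rewrite -lt0n.
  have r0 : 0 < (q %% N)%Z.
    by rewrite lt_neqAle modz_ge0// andbT eq_sym; apply: contra Nq => /eqP/dvdz_mod0P.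
  have rN : (q %% N)%Z < N%:Z by rewrite ltz_pmod.
  rewrite divr_gt0 ?ltr0z ?ltr0n//= ltr_pdivrMr ?ltr0n// mul1r.
  by rewrite -[N%:R]/(N%:Z%:~R) ltr_int.
by move: wN; rewrite subrX1 => /eqP; rewrite mulf_eq0 (negbTE w1) /= => /eqP ->; rewrite mulr0.
Qed.

Definition idot d (h : d.-tuple int) (z : d.-tuple nat) : int :=
  \sum_(j < d) tnth h j * (tnth z j)%:Z.

Lemma expi2pi_dot_frac d (h : d.-tuple int) (x : vec R d) :
  expi2pi (dot h [tuple of map (@fracpart R) x]) = expi2pi (dot h x).
Proof.
have -> : dot h x = dot h [tuple of map (@fracpart R) x] +
    (\sum_(j < d) tnth h j * Num.floor (tnth x j : R))%:~R.
  rewrite /dot rmorph_sum -big_split /=; apply: eq_bigr => j _.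
  by rewrite tnth_map rmorphM /= -mulrDr /fracpart subrK.
by rewrite expi2piDint.
Qed.

Lemma dot_lattice_point d N (h : d.-tuple int) z (Delta : vec R d) k :
  dot h (lattice_point N z Delta k) =
  k%:R * ((idot h z)%:~R / N%:R) + dot h Delta.
Proof.
rewrite /dot /idot rmorph_sum mulr_suml mulr_sumr -big_split /=.
apply: eq_bigr => j _; rewrite tnth_mktuple rmorphM /= mulrDr; congr (_ + _).
by rewrite -[(Posz _)%:~R]/((tnth z j)%:R); ring.
Qed.

(** The Fourier series is inserted at the N nodes; for each l the sum over the nodes is the
    character sum of (l - h).z, so only the l aliased with h survive. *)
Lemma has_sum_lattice_coef d N (f : vec R d -> R[i]) (c : d.-tuple int -> R[i]) h z
    (Delta : vec R d) : (0 < N)%N ->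
  (forall x, has_sum (fun l => c l * expi2pi (dot l x)) (f x)) ->
  has_sum (fun l => (if (N%:Z %| idot (subt l h) z)%Z then c l else 0) *
                    expi2pi (- dot h Delta) * expi2pi (dot l Delta))
    (lattice_coef N f h z Delta).
Proof.
move=> N0 fc; rewrite /lattice_coef.
set x := lattice_point N z Delta.
have := has_sumZ N%:R^-1 (has_sum_sum (index_enum 'I_N)
  (fun k : 'I_N => has_sumZ (expi2pi (- dot h (x k))) (fc [tuple of map (@fracpart R) (x k)]))).
under [in X in has_sum _ X -> _]eq_bigr do rewrite mulrC.
apply: eq_has_sum => l /=.
transitivity (N%:R^-1 * (\sum_(k < N) expi2pi (k%:R * ((idot (subt l h) z)%:~R / N%:R) : R)) *
   (c l * expi2pi (- dot h Delta) * expi2pi (dot l Delta))).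
  rewrite -mulrA mulr_suml; congr (_ * _); apply: eq_bigr => k _.
  have key : expi2pi (- dot h (x k)) * expi2pi (dot l (x k)) =
      expi2pi (k%:R * ((idot (subt l h) z)%:~R / N%:R)) *
      (expi2pi (- dot h Delta) * expi2pi (dot l Delta)).
    rewrite -!expi2piD; congr expi2pi.
    by rewrite addrC -dot_subt dot_lattice_point dot_subt; ring.
  by rewrite expi2pi_dot_frac mulrCA key; ring.
by rewrite character_sum//; case: ifP => _; rewrite ?mul1r ?mul0r.
Qed.
End lattice.

(** * Bad draws *)

Section bad_event.
Context {R : realType} {d N : nat}.
Variables (f : vec R d -> R[i]) (c : d.-tuple int -> R[i]) (A : {fset d.-tuple int}).
Hypothesis N_prime : prime N.
Hypothesis c_summable : (\esum_(h in [set: d.-tuple int]) (normc (c h))%:E < +oo)%E.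
Hypothesis f_sum : forall x, has_sum (fun l => c l * expi2pi (dot l x)) (f x).

(** Congruent indices are aliased for every z, so a random z can separate incongruent ones only. *)
Definition congruent (l h : d.-tuple int) : bool :=
  [forall j, (N%:Z %| tnth l j - tnth h j)%Z].

Hypothesis A_incongruent : forall h l, h \in A -> l \in A -> l != h -> ~~ congruent l h.

Let N_gt0 : (0 < N)%N := prime_gt0 N_prime.
Let N_gt1 : (1 < N)%N := prime_gt1 N_prime.

Definition aliasing (h l : d.-tuple int) (z : d.-tuple nat) : bool :=
  (N%:Z %| idot (subt l h) z)%Z.

Definition collision (h : d.-tuple int) (z : d.-tuple nat) : bool :=
  has (fun l => (l != h) && aliasing h l z) A.

Definition alias_coef h z l : R[i] :=
  if (l \notin A) && aliasing h l z then c l else 0.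

(** The unimodular factor exp(2 pi i h.Delta) turns the error into a Fourier series in Delta, to
    which [bessel] applies. *)
Lemma alias_error h z (Delta : vec R d) : h \in A -> ~~ collision h z ->
  has_sum (fun l => alias_coef h z l * expi2pi (dot l Delta))
    (expi2pi (dot h Delta) * (lattice_coef N f h z Delta - c h)).
Proof.
move=> hA /hasPn noc.
have := has_sumZ (expi2pi (dot h Delta))
  (has_sumD (has_sum_lattice_coef h z Delta N_gt0 f_sum) (has_sum1 h (- c h))).
apply: eq_has_sum => l; rewrite -/(aliasing h l z) /alias_coef.
have e1 : expi2pi (dot h Delta) * expi2pi (- dot h Delta) = 1.
  by rewrite -expi2piD subrr expi2pi0.
have [->|lh] := eqVneq l h.
  rewrite hA mul0r /aliasing (_ : idot _ _ = 0) ?dvdz0.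
    by rewrite -mulrA -expi2piD addNr expi2pi0 mulr1 subrr mulr0.
  by rewrite /idot big1// => j _; rewrite tnth_mktuple subrr mul0r.
rewrite addr0; case: (boolP (l \in A)) => lA /=.
  by have := noc l lA; rewrite lh /= => /negbTE ->; rewrite !mul0r mulr0.
by case: ifP => _; rewrite ?mul0r ?mulr0// mulrA mulrCA e1 mulr1.
Qed.

Lemma alias_coef_summable h z :
  (\esum_(l in [set: d.-tuple int]) (normc (alias_coef h z l))%:E < +oo)%E.
Proof.
apply: le_lt_trans c_summable; apply: le_esum => l _; rewrite lee_fin /alias_coef.
by case: ifP => // _; rewrite normc0 normc_ge0.
Qed.

(** All shifts count as far when z has a collision, so that a draw outside [bad_draw] has neither a
    collision nor a large error. *)
Definition far_set h (t : R) (g : gvec_index d N) : set (vec R d) :=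
  if collision h (gvec g) then setT
  else [set Delta | t < normc (lattice_coef N f h (gvec g) Delta - c h) ^+ 2].

Lemma far_setE h t z : [set Delta | t < normc (lattice_coef N f h z Delta - c h) ^+ 2] =
  [set Delta : vec R d | t < normc (expi2pi (dot h Delta) * (lattice_coef N f h z Delta - c h)) ^+ 2].
Proof. by apply/seteqP; split => x /=; rewrite normcM normc_expi2pi mul1r. Qed.

Lemma measurable_far_set h t g : h \in A -> measurable (far_set h t g).
Proof.
move=> hA; rewrite /far_set; case: ifPn => // noc; rewrite far_setE.
have := measurable_sqr_normc_has_sum (alias_coef_summable h (gvec g)) (fun x => alias_error x hA noc).
move=> /(_ measurableT `]t, +oo[%classic (measurable_itv _)); rewrite setTI.
by congr measurable; apply/seteqP; split => x /=; rewrite in_itv/= andbT.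
Qed.

Lemma cube_far_set h t g : h \in A -> 0 <= t -> ~~ collision h (gvec g) ->
  (t%:E * cube_measure R d (far_set h t g) <=
   \esum_(l in [set: d.-tuple int]) (normc (alias_coef h (gvec g) l) ^+ 2)%:E)%E.
Proof.
move=> hA t0 noc.
apply: le_trans (bessel (alias_coef_summable h (gvec g)) (fun x => alias_error x hA noc)).
rewrite /far_set (negbTE noc) far_setE; apply: markov_gt => // [|x]; last exact: sqr_ge0.
exact: measurable_sqr_normc_has_sum (alias_coef_summable h (gvec g)) (fun x => alias_error x hA noc).
Qed.

Lemma card_aliasing h l : ~~ congruent l h ->
  (#|[set g : gvec_index d N | aliasing h l (gvec g)]%SET| * N.-1 <= #|gvec_index d N|)%N.
Proof.
rewrite negb_forall => /existsP[j Nj].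
have := @card_congruent d N N_gt1 (fun j => tnth l j - tnth h j) j N_prime Nj.
congr (_ * _ <= _)%N; apply: eq_card => g; rewrite !inE /aliasing /gvec_dot /idot.
by congr (_ %| _)%Z; apply: eq_bigr => i _; rewrite !tnth_mktuple.
Qed.

(** A union bound over the elements of [A] other than [h], none of them congruent to [h]. *)
Lemma card_collision h : h \in A ->
  (#|[set g : gvec_index d N | collision h (gvec g)]%SET| * N.-1 <= #|gvec_index d N| * (#|` A|).-1)%N.
Proof.
move=> hA.
apply: (@leq_trans (\sum_(l <- (A `\ h)%fset)
    #|[set g : gvec_index d N | aliasing h l (gvec g)]%SET| * N.-1)%N).
  rewrite -big_distrl /= leq_mul2r; apply/orP; right.
  have cs (P : pred (gvec_index d N)) : #|[set g | P g]%SET| = (\sum_g P g)%N.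
    rewrite -sum1_card big_mkcond; apply: eq_bigr => g _.
    by rewrite inE; case: (P g).
  have -> : (\sum_(i <- (A `\ h)%fset) #|[set g : gvec_index d N | aliasing h i (gvec g)]%SET| =
      \sum_(i <- (A `\ h)%fset) \sum_(g : gvec_index d N) aliasing h i (gvec g))%N.
    by apply: eq_bigr => i _; exact: cs.
  rewrite cs.
  rewrite exchange_big /=; apply: leq_sum => g _.
  case: (boolP (collision _ _)) => // /hasP[l lA /andP[lh al]].
  have lAh : l \in (A `\ h)%fset by rewrite !inE lh.
  by rewrite (big_fsetD1 l lAh)/= al.
have -> : (#|gvec_index d N| * (#|` A|).-1)%N = (\sum_(l <- (A `\ h)%fset) #|gvec_index d N|)%N.
  rewrite big_const_seq count_predT iter_addn_0; congr (_ * _)%N.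
  by rewrite (cardfsD1 h A) hA.
rewrite big_seq [leqRHS]big_seq; apply: leq_sum => l; rewrite !inE => /andP[lh lA].
by apply: card_aliasing; apply: A_incongruent.
Qed.

(* Bounds the probability over z that l is aliased with h. *)
Definition congruence_prob (h l : d.-tuple int) : R :=
  if congruent l h then 1 else (N%:R - 1)^-1.

Let N1_gt0 : 0 < N%:R - 1 :> R.
Proof. by rewrite subr_gt0 ltr1n. Qed.

Let N1E : N%:R - 1 = N.-1%:R :> R.
Proof. by rewrite -subn1 natrB. Qed.

Lemma congruence_prob_gt0 h l : 0 < congruence_prob h l.
Proof. by rewrite /congruence_prob; case: ifP => _ //; rewrite invr_gt0. Qed.

Lemma congruence_prob_le1 h l : congruence_prob h l <= 1.
Proof.
rewrite /congruence_prob; case: ifP => _ //; rewrite invf_le1// lerBrDl.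
by rewrite -[1 + 1]/(2%:R) ler_nat.
Qed.

Definition tail_sqr l : R := if l \notin A then normc (c l) ^+ 2 else 0.

Lemma tail_sqr_ge0 l : 0 <= tail_sqr l.
Proof. by rewrite /tail_sqr; case: ifP => _ //; exact: sqr_ge0. Qed.

Variable T : R.
Hypothesis tail_le : (\esum_(l in [set: d.-tuple int]) (tail_sqr l)%:E <= T%:E)%E.

(** The bound V_h on the mean squared contribution from outside [A]. *)
Definition alias_mean h : \bar R :=
  (\esum_(l in [set: d.-tuple int]) (tail_sqr l * congruence_prob h l)%:E)%E.

Lemma alias_mean_fin h : alias_mean h \is a fin_num.
Proof.
rewrite ge0_fin_numE; last first.
  by apply: esum_ge0 => l _; rewrite lee_fin mulr_ge0 ?tail_sqr_ge0// ltW// congruence_prob_gt0.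
apply: le_lt_trans (le_lt_trans tail_le (ltry T)); apply: le_esum => l _.
by rewrite lee_fin ler_piMr ?tail_sqr_ge0// congruence_prob_le1.
Qed.

(** For a collision-free z, [bessel] makes this a bound on the mean over Delta of the squared error
    at [h]. *)
Definition alias_sqr h (g : gvec_index d N) : \bar R :=
  (\esum_(l in [set: d.-tuple int]) (normc (alias_coef h (gvec g) l) ^+ 2)%:E)%E.

Lemma sqr_alias_coef h z l :
  normc (alias_coef h z l) ^+ 2 = tail_sqr l * (aliasing h l z)%:R.
Proof.
have n0 : normc (0 : R[i]) ^+ 2 = 0 by rewrite normc0 expr0n.
rewrite /alias_coef /tail_sqr.
by case: (l \notin A); case: (aliasing h l z); rewrite ?mulr1 ?mulr0 ?mul0r //; exact: n0.
Qed.

Lemma alias_sqr_ge0 h g : (0 <= alias_sqr h g)%E.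
Proof. by apply: esum_ge0 => l _; rewrite lee_fin sqr_ge0. Qed.

Lemma alias_sqr_fin h g : alias_sqr h g \is a fin_num.
Proof.
rewrite ge0_fin_numE ?alias_sqr_ge0//.
apply: le_lt_trans (le_lt_trans tail_le (ltry T)); apply: le_esum => l _.
rewrite lee_fin sqr_alias_coef ler_piMr ?tail_sqr_ge0//.
by case: (aliasing _ _ _).
Qed.

Let n : R := #|gvec_index d N|%:R.

Let n_gt0 : 0 < n. Proof. by rewrite ltr0n card_gvec_index_gt0. Qed.

(** After exchanging the sums, each l outside [A] is counted once for every z aliasing it with [h],
    and these are at most a fraction [congruence_prob h l] of all z. *)
Lemma sum_alias_sqr h :
  \sum_g fine (alias_sqr h g) <= n * fine (alias_mean h).
Proof.
rewrite -lee_fin -sumEFin EFinM fineK ?alias_mean_fin//.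
under eq_bigr do rewrite fineK ?alias_sqr_fin//.
rewrite -esum_sum; last by move=> l g _ _; rewrite lee_fin sqr_ge0.
have -> : (n%:E * alias_mean h = \sum_(g : gvec_index d N) alias_mean h)%E.
  by rewrite -(fineK (alias_mean_fin h)) sumEFin sumr_const -EFinM mulr_natl.
rewrite -esum_sum; last first.
  by move=> l g _ _; rewrite lee_fin mulr_ge0 ?tail_sqr_ge0// ltW// congruence_prob_gt0.
apply: le_esum => l _; rewrite !sumEFin lee_fin.
under eq_bigr do rewrite sqr_alias_coef.
rewrite -!mulr_sumr ler_wpM2l ?tail_sqr_ge0// sumr_const -natr_sum -[leRHS]mulr_natl -/n.
have cs : (\sum_(g : gvec_index d N) aliasing h l (gvec g))%N =
    #|[set g : gvec_index d N | aliasing h l (gvec g)]%SET|.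
  rewrite -sum1_card [RHS]big_mkcond; apply: eq_bigr => g _.
  by rewrite inE; case: (aliasing _ _ _).
rewrite /congruence_prob cs; case: ifPn => lh; first by rewrite mulr1 ler_nat max_card.
rewrite ler_pdivlMr// N1E -natrM ler_nat.
exact: card_aliasing.
Qed.

Variables (p1 p2 : R).
Hypothesis p2_gt0 : 0 < p2.
Hypothesis cardA : #|` A|.-1%:R <= p1 * (N%:R - 1).

(* V_h / p2; it may be 0, and then the good draws have no error at all. *)
Definition threshold h : R := fine (alias_mean h) / p2.

Definition bad_draw h : set (d.-tuple nat * vec R d) :=
  gvec_fiber (far_set h (threshold h)).

Lemma measurable_bad_draw h : h \in A -> measurable (bad_draw h).
Proof. by move=> hA; apply: measurable_gvec_fiber => g; exact: measurable_far_set. Qed.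

Lemma threshold_ge0 h : 0 <= threshold h.
Proof.
rewrite divr_ge0 ?(ltW p2_gt0)// fine_ge0// esum_ge0// => l _.
by rewrite lee_fin mulr_ge0 ?tail_sqr_ge0// ltW// congruence_prob_gt0.
Qed.

Lemma good_draw h z Delta : h \in A -> ~ bad_draw h (z, Delta) ->
  normc (lattice_coef N f h z Delta - c h) ^+ 2 <= threshold h.
Proof.
move=> hA nbad; have [|zG] := pselect (generating_vectors N z); last first.
  by case: nbad; right.
rewrite generating_vectorsE => -[g _ gz]; rewrite leNgt; apply/negP => lt.
apply: nbad; left; rewrite (bigD1 g)//=; left; split => //=.
by rewrite /far_set gz; case: ifP.
Qed.

Lemma prob_far_set h g : h \in A ->
  (cube_measure R d (far_set h (threshold h) g) <=
   ((collision h (gvec g))%:R + fine (alias_sqr h g) / threshold h)%:E)%E.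
Proof.
move=> hA; have := measurable_far_set (threshold h) g hA => mfar.
case: (boolP (collision h (gvec g))) => coll.
  apply: le_trans (probability_le1 _ mfar) _.
  by rewrite lee_fin lerDl divr_ge0 ?threshold_ge0// fine_ge0// alias_sqr_ge0.
rewrite add0r; have [t0|t0] := ltP 0 (threshold h).
  rewrite EFinM fineK ?alias_sqr_fin// muleC lee_pdivlMl//.
  exact: cube_far_set (threshold_ge0 h) coll.
(* Then V_h = 0; as every [congruence_prob] is positive, all coefficients outside [A] vanish and the
   error is exactly 0. *)
have {}t0 : threshold h = 0 by apply/eqP; rewrite eq_le t0 threshold_ge0.
rewrite t0 invr0 mulr0 /far_set (negbTE coll).
rewrite (_ : [set _ | _] = set0) ?measure0//; apply/seteqP; split => x //=.
have c0 l : tail_sqr l = 0.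
  have am0 : alias_mean h = 0%E.
    move: t0 => /eqP; rewrite /threshold mulf_eq0 invr_eq0 (gt_eqF p2_gt0) orbF => /eqP am0.
    by rewrite -[LHS]fineK ?alias_mean_fin// am0.
  have : ((tail_sqr l * congruence_prob h l)%:E <= alias_mean h)%E.
    have := @sum_fset_le_esum R _ (fun l => tail_sqr l * congruence_prob h l) [fset l]%fset.
    rewrite big_seq_fset1; apply => i.
    by rewrite mulr_ge0 ?tail_sqr_ge0// ltW// congruence_prob_gt0.
  rewrite am0 lee_fin pmulr_lle0 ?congruence_prob_gt0// => le0.
  by apply/eqP; rewrite eq_le le0 tail_sqr_ge0.
have := alias_error x hA coll.
have z0 : (fun l => alias_coef h (gvec g) l * expi2pi (dot l x)) =1 fun=> 0.
  move=> l; rewrite (@eq0_normc _ (alias_coef _ _ _)) ?mul0r//.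
  by apply/eqP; rewrite -sqrf_eq0 sqr_alias_coef c0 mul0r.
move=> /(eq_has_sum z0) /has_sum_uniq /(_ has_sum0) e0.
have -> : normc (lattice_coef N f h (gvec g) x - c h) = 0.
  by rewrite -[LHS]mul1r -(normc_expi2pi (dot h x)) -normcM e0 normc0.
by rewrite expr0n ltxx.
Qed.

Lemma prob_bad_draw h : h \in A ->
  ((uniform_generating_vector R d N \x cube_measure R d) (bad_draw h) <= (p1 + p2)%:E)%E.
Proof.
move=> hA; apply: le_trans (uniform_gvec_fiber _ _ _) _ => //.
  by move=> g; exact: measurable_far_set.
apply: (@le_trans _ _ (\sum_g (n^-1 * ((collision h (gvec g))%:R +
    fine (alias_sqr h g) / threshold h))%:E)%E).
  apply: lee_sum => g _; rewrite EFinM lee_wpmul2l ?lee_fin ?invr_ge0 ?(ltW n_gt0)//.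
  exact: prob_far_set.
rewrite sumEFin lee_fin -mulr_sumr big_split /= -mulr_suml mulrDr lerD//.
  rewrite ler_pdivrMl// -natr_sum -(ler_pM2r N1_gt0) -mulrA.
  apply: (@le_trans _ _ (n * #|` A|.-1%:R)); last by rewrite ler_wpM2l// ltW.
  rewrite N1E -!natrM ler_nat.
  apply: leq_trans (card_collision hA); rewrite leq_mul2r; apply/orP; right.
  rewrite -sum1_card [leqRHS]big_mkcond; apply: leq_sum => g _.
  by rewrite inE; case: (collision _ _).
(* For a zero threshold the quotients are 0 by the convention on division; otherwise
   [p2 * threshold h] is V_h, which bounds the average of [alias_sqr]. *)
have [t0|t0] := ltP 0 (threshold h); last first.
  have -> : threshold h = 0 by apply/eqP; rewrite eq_le t0 threshold_ge0.
  by rewrite invr0 !mulr0 ltW.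
have pt : p2 * threshold h = fine (alias_mean h).
  by rewrite /threshold mulrC divfK// gt_eqF.
by rewrite mulrA ler_pdivrMr// ler_pdivrMl// pt; exact: sum_alias_sqr.
Qed.

Hypothesis p1_ge0 : 0 <= p1.

(** Since [A] has no two congruent elements, [l] is congruent to at most one of them, which
    contributes 1, while the other |A| - 1 terms are 1/(N-1) each and sum to at most [p1]. *)
Lemma sum_congruence_prob l : \sum_(h <- A) congruence_prob h l <= 1 + p1.
Proof.
have cn h' : \sum_(h <- (A `\ h')%fset) (N%:R - 1 : R)^-1 <= #|` A `\ h'|%fset%:R / (N%:R - 1).
  by rewrite big_const_seq count_predT iter_addr_0 -[leLHS]mulr_natl.
have [/hasP[h0 h0A lh0]|/hasPn nolh] := boolP (has (congruent l) A).
  rewrite (big_fsetD1 h0)//= {1}/congruence_prob lh0 lerD2l.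
  apply: (@le_trans _ _ (#|` A `\ h0|%fset%:R / (N%:R - 1))).
    apply: le_trans (cn h0); rewrite big_seq [leRHS]big_seq; apply: ler_sum => h.
    rewrite !inE => /andP[hh0 hA]; rewrite /congruence_prob; case: ifP => // lh.
    have := A_incongruent h0A hA hh0; rewrite negb_forall => /existsP[j].
    move=> /negP; case.
    have -> : tnth h j - tnth h0 j = (tnth l j - tnth h0 j) - (tnth l j - tnth h j) by ring.
    by apply: rpredB; [exact: (forallP lh0)|exact: (forallP lh)].
  by rewrite ler_pdivrMr//; apply: le_trans cardA; rewrite (cardfsD1 h0 A) h0A.
(* With no element of [A] congruent to [l], one more term 1/(N-1) <= 1 takes the place of the 1. *)
apply: (@le_trans _ _ (\sum_(h <- A) (N%:R - 1)^-1)).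
  rewrite big_seq [leRHS]big_seq; apply: ler_sum => h hA.
  by rewrite /congruence_prob (negbTE (nolh h hA)).
rewrite big_const_seq count_predT iter_addr_0 -[leLHS]mulr_natl ler_pdivrMr// mulrDl mul1r.
apply: (@le_trans _ _ (1 + #|` A|.-1%:R)).
  by rewrite -[1]/(1%:R) -natrD ler_nat add1n leqSpred.
by rewrite lerD// N1E ler1n -subn1 subn_gt0.
Qed.

Lemma sum_alias_mean : \sum_(h <- A) fine (alias_mean h) <= (1 + p1) * T.
Proof.
rewrite -lee_fin -sumEFin; under eq_bigr do rewrite fineK ?alias_mean_fin//.
rewrite -esum_sum; last first.
  by move=> l h _ _; rewrite lee_fin mulr_ge0 ?tail_sqr_ge0// ltW// congruence_prob_gt0.
under eq_esum do rewrite sumEFin.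
apply: (@esum_le_scale _ _ tail_sqr) => // [||l]; [exact: tail_sqr_ge0|exact: addr_ge0|].
by rewrite -mulr_sumr mulrC ler_wpM2r ?tail_sqr_ge0// sum_congruence_prob.
Qed.

(** In a good draw the real and the imaginary part are both within the square root of the threshold,
    so [median_dist] applies to each; adding the two squares gives the factor 2. *)
Lemma median_coef_error m (w : m.-tuple (d.-tuple nat * vec R d)) h :
  odd m -> h \in A -> (\sum_(j < m) (tnth w j \in bad_draw h) < uphalf m)%N ->
  normc (median_coef N w f h - c h) ^+ 2 <= 2 * threshold h.
Proof.
move=> om hA few; set r := Num.sqrt (threshold h).
have r0 : 0 <= r by exact: sqrtr_ge0.
have rE : r ^+ 2 = threshold h by rewrite sqr_sqrtr// threshold_ge0.
pose L (p : d.-tuple nat * vec R d) := lattice_coef N f h p.1 p.2.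
have gen (proj : R[i] -> R) : (forall u v, `|proj u - proj v| <= normc (u - v)) ->
    `|median [seq proj u | u <- [seq L p | p <- w]] - proj (c h)| <= r.
  move=> projP; apply: median_dist; first by rewrite !size_map size_tuple.
  rewrite !size_map size_tuple; apply: leq_ltn_trans few.
  rewrite !count_map -sum1_count big_mkcond big_tuple; apply: leq_sum => j _ /=.
  case: ifP => // far; case: (boolP (_ \in _)) => // /negP nb; move: far.
  rewrite ltNge => /negP; case; apply: le_trans (projP _ _) _.
  rewrite -ler_sqr ?nnegrE ?normc_ge0// rE /L.
  apply: good_draw => //; rewrite -surjective_pairing => bad; apply: nb; exact: mem_set.
have := gen _ Re_dist; have := gen _ Im_dist.
rewrite sqr_normcE /median_coef /cmedian; case: (c h) => a b /=.
have sq (x : R) : `|x| <= r -> x ^+ 2 <= threshold h.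
  by move=> xr; rewrite -rE -(real_normK (num_real x)) ler_sqr ?nnegrE.
by move=> /sq h2 /sq h1; rewrite mulr_natl mulr2n; apply: lerD.
Qed.

Lemma L2_error m (w : m.-tuple (d.-tuple nat * vec R d)) :
  odd m -> (forall h, h \in A ->
    (\sum_(j < m) (tnth w j \in bad_draw h) < uphalf m)%N) ->
  (\int[cube_measure R d]_x (normc (f x - \sum_(h <- A) median_coef N w f h * expi2pi (dot h x)) ^+ 2)%:E
    <= ((2 * (1 + p1) / p2 + 1) * T)%:E)%E.
Proof.
move=> om few; set med := median_coef N w f.
(* The error has the coefficients [c l] outside [A] and [c l - med l] on [A]; Bessel's inequality
   splits its square into the tail and the coefficient errors. *)
pose a l := c l + (if l \in A then - med l else 0).
have suma (b : d.-tuple int -> R) : (forall l, 0 <= b l) ->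
    (\esum_(l in [set: d.-tuple int]) (if l \in A then b l else 0)%:E = (\sum_(l <- A) b l)%:E)%E.
  move=> b0; transitivity (\esum_(l in [set` A]) (b l)%:E)%E.
    rewrite [RHS]esum_mkcond; apply: eq_esum => l _.
    by rewrite mem_setE; case: ifP.
  rewrite esum_fset//; first by rewrite fsbig_finite//= set_fsetK sumEFin.
  by move=> l _; rewrite lee_fin.
have asum : (\esum_(l in [set: d.-tuple int]) (normc (a l))%:E < +oo)%E.
  apply: (@le_lt_trans _ _ (\esum_(l in [set: d.-tuple int])
      ((normc (c l))%:E + (if l \in A then normc (med l) else 0)%:E))%E).
    apply: le_esum => l _; rewrite -EFinD lee_fin /a.
    apply: le_trans (le_normcD _ _) _; rewrite lerD2l.
    by case: ifP => _; rewrite ?normcN ?normc0.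
  rewrite esumD; [|by move=> l _; rewrite lee_fin normc_ge0|]; last first.
    by move=> l _; rewrite lee_fin; case: ifP => // _; exact: normc_ge0.
  rewrite suma; last by move=> l; exact: normc_ge0.
  by rewrite lte_add_pinfty// ltry.
have fa x : has_sum (fun l => a l * expi2pi (dot l x))
    (f x - \sum_(h <- A) med h * expi2pi (dot h x)).
  rewrite -sumrN.
  have := has_sumD (f_sum x) (has_sum_sum A (fun h => has_sum1 h (- (med h * expi2pi (dot h x))))).
  apply: eq_has_sum => l; rewrite /a mulrDl; congr (_ + _).
  case: ifPn => lA.
    rewrite (big_fsetD1 l)//= eqxx big_seq big1 ?addr0 ?mulNr// => h.
    by rewrite !inE eq_sym => /andP[/negbTE ->].
  rewrite mul0r big_seq big1// => h hA; case: eqP => // lh.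
  by rewrite -lh (negbTE lA) in hA.
apply: le_trans (bessel asum fa) _.
apply: (@le_trans _ _ (\esum_(l in [set: d.-tuple int])
    ((tail_sqr l)%:E + (if l \in A then normc (med l - c l) ^+ 2 else 0)%:E))%E).
  apply: le_esum => l _; rewrite -EFinD lee_fin /a /tail_sqr.
  case: (boolP (l \in A)) => lA /=; last by rewrite !addr0.
  by rewrite add0r -normcN opprB.
rewrite esumD; [|by move=> l _; rewrite lee_fin tail_sqr_ge0|]; last first.
  by move=> l _; rewrite lee_fin; case: ifP => // _; exact: sqr_ge0.
rewrite suma; last by move=> l; exact: sqr_ge0.
rewrite addeC mulrDl mul1r EFinD; apply: leeD => //; rewrite lee_fin.
apply: (@le_trans _ _ (\sum_(h <- A) 2 * threshold h)).
  rewrite big_seq [leRHS]big_seq; apply: ler_sum => h hA.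
  by apply: median_coef_error => //; exact: few.
rewrite -mulr_sumr /threshold -mulr_suml.
have -> : 2 * (1 + p1) / p2 * T = 2 * ((1 + p1) * T / p2) by ring.
rewrite ler_wpM2l// ler_wpM2r ?invr_ge0 ?(ltW p2_gt0)//; exact: sum_alias_mean.
Qed.

Lemma prob_good_draws m : odd m ->
  exists E : set (m.-tuple (d.-tuple nat * vec R d)),
  [/\ measurable E,
    ((1 - #|` A|%:R * (4 * (p1 + p2)) ^+ uphalf m)%:E <= draw_law R d N m E)%E &
    forall w, E w -> forall h, h \in A ->
      (\sum_(j < m) (tnth w j \in bad_draw h) < uphalf m)%N].
Proof.
move=> om; set k := uphalf m.
pose S h := [set w : m.-tuple (d.-tuple nat * vec R d) |
  (k <= \sum_(j < m) (tnth w j \in bad_draw h))%N].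
have mS h : h \in A -> measurable (S h).
  by move=> hA; apply: measurable_count_ge; exact: measurable_bad_draw.
have [mB leB] := measure_bigsetU_le (draw_law R d N m) mS.
(* For each [h] in the union bound, [iid_tail] and [bin_uphalf_le] give (4 (p1 + p2))^ceil(m/2). *)
exists (~` \big[setU/set0]_(h <- A) S h); split; first exact: measurableC.
  rewrite probability_setC// EFinB leeB//; apply: le_trans leB _.
  apply: (@le_trans _ _ (\sum_(h <- A) ((4 * (p1 + p2)) ^+ k)%:E)%E); last first.
    by rewrite sumEFin lee_fin big_const_seq count_predT iter_addr_0 -[leLHS]mulr_natl.
  rewrite big_seq [leRHS]big_seq; apply: lee_sum => h hA.
  apply: le_trans (iid_tail _ _ (measurable_bad_draw hA) (prob_bad_draw hA)) _.
  by rewrite lee_fin bin_uphalf_le// addr_ge0// ltW.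
move=> w nB h hA; rewrite ltnNge; apply/negP => kw; apply: nB.
by rewrite (big_fsetD1 h)//=; left.
Qed.

End bad_event.

(** * The final error bound and its constants *)

Section L2norm.
Context {R : realType} {d : nat}.

Lemma L2norm_sqr (g : vec R d -> R[i]) (K : R) :
  (\int[cube_measure R d]_x (normc (g x) ^+ 2)%:E <= K%:E)%E ->
  (L2norm g ^+ 2 <= K%:E)%E.
Proof.
rewrite /L2norm unlock.
have -> : (\int[cube_measure R d]_x `|(normc (g x))%:E| `^ 2 =
    \int[cube_measure R d]_x (normc (g x) ^+ 2)%:E)%E.
  apply: eq_integral => x _; rewrite abse_EFin poweR_EFin.
  by rewrite ger0_norm ?normc_ge0// powR_mulrn ?normc_ge0.
have : (0 <= \int[cube_measure R d]_x (normc (g x) ^+ 2)%:E)%E.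
  by apply: integral_ge0 => x _; rewrite lee_fin sqr_ge0.
case: (\int[_]_x _)%E => [r| |] //; rewrite !lee_fin => r0 rK.
by rewrite powR12_sqrt// -expr2 sqr_sqrtr.
Qed.
End L2norm.

(** With L = 1 + tau ln M the left side is (L + 1)/tau = ln M + 2/tau, and ln M <= ln(N-1) - 1/tau
    because P_N >= 1; finally N/(N-1) >= 1. *)
Lemma Nstar_bound (R : realType) (d N : nat) (alpha : R) gamma (tau : R) :
  0 < tau -> (forall j, 0 < gamma j) -> 1 < N%:R :> R -> 1 < Nstar d N alpha gamma tau ->
  (1 + (1 + tau * ln (Nstar d N alpha gamma tau))^-1) /
    (tau / (1 + tau * ln (Nstar d N alpha gamma tau))) <=
  tau^-1 + N%:R / (N%:R - 1) * ln (N%:R - 1).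
Proof.
move=> tau0 gamma0 N1 Ns1; set M := Nstar _ _ _ _ _.
have M0 : 0 < M by exact: lt_trans Ns1.
have N10 : 0 < N%:R - 1 :> R by rewrite subr_gt0.
have lnM0 : 0 < ln M by exact: ln_gt0.
have lnN : 0 <= ln N%:R :> R by rewrite ln_ge0// ltW.
have PN1 : 1 <= PN d N alpha gamma tau.
  rewrite /PN; elim/big_ind: _ => // [x y x1 y1|j _]; first by rewrite -[1]mulr1 ler_pM.
  by rewrite lerDl !mulr_ge0 ?powR_ge0// addr_ge0// mulr_ge0// ltW.
have ME : ln M <= ln (N%:R - 1) - tau^-1.
  have e : ln M + tau^-1 = ln (M * expR tau^-1).
    by rewrite lnM ?posrE ?expR_gt0// expRK.
  have Me0 : 0 < M * expR tau^-1 by apply: mulr_gt0 => //; exact: expR_gt0.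
  rewrite lerBrDr e ler_ln ?posrE//.
  rewrite /M /Nstar invfM mulrA mulrAC divfK ?gt_eqF ?expR_gt0//.
  by rewrite ler_pdivrMr ?(lt_le_trans ltr01 PN1)// ler_peMr// ltW.
have L0 : 0 < 1 + tau * ln M by rewrite addr_gt0 ?mulr_gt0.
have -> : (1 + (1 + tau * ln M)^-1) / (tau / (1 + tau * ln M)) = ln M + 2 / tau.
  by field; rewrite !gt_eqF.
have lnN1 : 0 <= ln (N%:R - 1) :> R.
  apply: le_trans (ltW lnM0) (le_trans ME _); rewrite gerBl.
  by rewrite invr_ge0 ltW.
have : ln (N%:R - 1) <= N%:R / (N%:R - 1) * ln (N%:R - 1) :> R.
  by rewrite ler_peMl// ler_pdivlMr// mul1r gerBl.
have -> : 2 / tau = tau^-1 + tau^-1 by field; rewrite gt_eqF.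
move: ME; set a := ln _; set b := tau^-1; set e := _ * ln _; lra.
Qed.

(** The good event depends on [f] through the bad draws, so [f] is fixed before the probability is
    taken. *)
Theorem theorem10 (R : realType) (d : nat) (alpha : R) (gamma : nat -> R)
    (tau delta : R) (N m : nat)
    (d_gt0 : (0 < d)%N)
    (alpha_gt : 1 / 2 < alpha)
    (gamma_le1 : gamma 0%N <= 1)
    (gamma_noninc : forall j, gamma j.+1 <= gamma j)
    (gamma_gt0 : forall j, 0 < gamma j)
    (tau_gt0 : 0 < tau)
    (delta_gt0 : 0 < delta) (delta_lt1 : delta < 1)
    (N_prime : prime N)
    (Nstar_ge1 : 1 <= Nstar d N alpha gamma tau)
    (Nstar_lt : Nstar d N alpha gamma tau < N%:R / 2)
    (N_large :
       4 * (1 + tau) / (1 + tau * ln (Nstar d N alpha gamma tau)) < 1)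
    (m_odd : odd m)
    (m_large :
       (1 + (N%:R - 1) / (1 + tau * ln (Nstar d N alpha gamma tau))) *
       (4 * (1 + tau) / (1 + tau * ln (Nstar d N alpha gamma tau)))
         ^+ uphalf m <= delta) :
  forall f : vec R d -> R[i], korobov_space alpha gamma f ->
    with_probability_at_least (draw_law R d N m) (1 - delta)
      [set w | (L2norm (fun x => f x
                  - median_algorithm alpha gamma tau N w f x)%R ^+ 2 <=
                (korobov_norm alpha gamma f ^+ 2
                   / Nstar d N alpha gamma tau `^ (2 * alpha)
                 * (2 * tau^-1 + 1
                    + 2 * N%:R / (N%:R - 1) * ln (N%:R - 1)))%:E)%E].
Proof.
move=> f [_ c_summable f_sum sq_fin].
set M := Nstar d N alpha gamma tau in Nstar_ge1 Nstar_lt N_large m_large *.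
set L := 1 + tau * ln M in N_large m_large.
have alpha_gt0 : 0 < alpha by apply: lt_trans alpha_gt; rewrite divr_gt0.
have gamma_le j : gamma j <= 1.
  by elim: j => [|j IH] //; apply: le_trans IH.
have L_gt0 : 0 < L.
  by rewrite ltr_pwDl// mulr_ge0 ?ln_ge0// ltW.
(* N_* = 1 would give L = 1 and turn [N_large] into 4 (1 + tau) < 1. *)
have Nstar_gt1 : 1 < M.
  rewrite lt_neqAle Nstar_ge1 andbT; apply/eqP => M1.
  move: N_large; rewrite /L -M1 ln1 mulr0 addr0 divr1; have := tau_gt0; lra.
have N1 : 1 < N%:R :> R by rewrite ltr1n prime_gt1.
have M_leN : M <= N%:R by apply: ltW; apply: lt_le_trans Nstar_lt _; rewrite ler_pdivrMr//; lra.
have [s [sP size_s]] := index_set_count alpha_gt0 gamma_gt0 gamma_le tau_gt0 Nstar_gt1 M_leN.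
pose A := [fset h in s | `[< index_set N alpha gamma tau h >]]%fset.
have AP h : h \in A <-> index_set N alpha gamma tau h.
  rewrite !inE; split => [/andP[_ /asboolP]//|hA]; rewrite sP//=; exact/asboolP.
have cardA : #|` A|%:R <= 1 + (N%:R - 1) / L.
  apply: le_trans size_s; rewrite ler_nat.
  by apply: uniq_leq_size (fset_uniq A) _ => h; rewrite !inE => /andP[].
have setA : index_set N alpha gamma tau = [set` A].
  by apply/seteqP; split => h /=; [move/AP|move/AP].
(* The coordinates of [h] and [l] are at most N_* < N/2 in absolute value, so a difference divisible
   by N must be 0. *)
have incong h l : h \in A -> l \in A -> l != h -> ~~ congruent (N := N) l h.
  move=> /AP hA /AP lA; apply: contra => /forallP lh; apply/eqP/eq_from_tnth => j.
  have hj := index_set_le alpha_gt0 gamma_gt0 gamma_le Nstar_gt1 j hA.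
  have lj := index_set_le alpha_gt0 gamma_gt0 gamma_le Nstar_gt1 j lA.
  have := lh j; rewrite dvdzE /= => dv; apply/eqP; rewrite -subr_eq0 -absz_eq0.
  apply: contraTT dv; rewrite -lt0n => gt0; apply/negP => /(dvdn_leq gt0).
  apply/negP; rewrite -ltnNge -(ltr_nat R) natr_absz intr_norm rmorphB /=.
  apply: le_lt_trans (ler_normB _ _) _; rewrite -/M in hj lj; move: hj lj Nstar_lt.
  by set u := `|_|; set v := `|_|; lra.
pose T := korobov_norm alpha gamma f ^+ 2 / M `^ (2 * alpha).
have M0 : 0 < M by exact: lt_trans Nstar_gt1.
have Mp : 0 < M `^ (2 * alpha) by exact: powR_gt0.
have w0 (h : d.-tuple int) : 0 <= korobov_weight alpha gamma h.
  by rewrite prodr_ge0// => j _; rewrite le_max ler01 orbT.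
have sq0 : (0 <= korobov_sqnorm alpha gamma f)%E.
  by apply: esum_ge0 => h _; rewrite lee_fin mulr_ge0 ?sqr_ge0.
(* Outside [A] the Korobov weight exceeds M^(2 alpha), so the tail is at most the squared norm
   divided by M^(2 alpha). *)
have tail_le : (\esum_(l in [set: d.-tuple int]) (tail_sqr (fourier_coef f) A l)%:E <= T%:E)%E.
  rewrite /T /korobov_norm sqr_sqrtr ?fine_ge0// mulrC.
  apply: (@esum_le_scale _ _ (fun h => normc (fourier_coef f h) ^+ 2 * korobov_weight alpha gamma h)).
  - by move=> h; rewrite mulr_ge0 ?sqr_ge0.
  - by rewrite invr_ge0 ltW.
  - move=> l; rewrite /tail_sqr; case: ifPn => lA; last first.
      by apply: mulr_ge0; [rewrite invr_ge0 ltW|rewrite mulr_ge0 ?sqr_ge0].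
    rewrite mulrCA ler_peMr ?sqr_ge0// ler_pdivlMl// mulr1 leNgt; apply/negP => lt.
    by move/negP: lA; apply; apply/AP; rewrite /index_set /= ltW.
  - by rewrite fineK// ge0_fin_numE.
(* [p1] accounts for collisions and [p2] for Markov's inequality; 4 (p1 + p2) is the base of the
   power in [m_large]. *)
pose p1 := L^-1; pose p2 := tau / L.
have p2_gt0 : 0 < p2 by rewrite divr_gt0.
have p1_ge0 : 0 <= p1 by rewrite invr_ge0 ltW.
have cardA1 : #|` A|.-1%:R <= p1 * (N%:R - 1).
  (* An empty [A] is treated apart, because its truncated predecessor is 0 as well. *)
  rewrite mulrC; move: cardA; case: (#|` A|) => [_|n] /=.
    by rewrite mulr_ge0// subr_ge0 ltW.
  by rewrite -natr1 addrC lerD2l.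
have [E [mE PE EP]] := prob_good_draws N_prime c_summable f_sum incong tail_le p2_gt0 cardA1 p1_ge0 m_odd.
exists E; split => //; last first.
  apply: le_trans PE; rewrite lee_fin lerD2l lerN2; apply: le_trans m_large.
  have -> : 4 * (p1 + p2) = 4 * (1 + tau) / L by rewrite /p1 /p2; field; rewrite gt_eqF.
  by rewrite ler_wpM2r// exprn_ge0// divr_ge0 ?(ltW L_gt0)// mulr_ge0// addr_ge0// ltW.
move=> w Ew /=; apply: L2norm_sqr.
under eq_integral do rewrite /median_algorithm setA fsbig_finite//= set_fsetK.
apply: le_trans (L2_error N_prime c_summable f_sum incong tail_le p2_gt0 cardA1 p1_ge0 m_odd (EP w Ew)) _.
rewrite lee_fin -/T mulrC ler_wpM2l//; first by rewrite divr_ge0 ?sqr_ge0// ltW.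
(* Twice this estimate, plus 1 for the tail, is the constant of the theorem. *)
have := Nstar_bound tau_gt0 gamma_gt0 N1 Nstar_gt1; rewrite -/M -/L -/p1 -/p2.
set x := (1 + p1) / p2; set y := N%:R / _ * ln _ => xy.
have -> : 2 * (1 + p1) / p2 = 2 * x by rewrite /x mulrA.
have -> : 2 * N%:R / (N%:R - 1) * ln (N%:R - 1) = 2 * y by rewrite /y !mulrA.
move: xy; lra.
Qed.
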